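(* Let $m>n$ and let $\Sigma$ be an $n$-dimensional complete (without boundary) self-shrinker properly immersed in $\mathbb{R}^m$. 1. Let $k\in\{m-n,\ldots,m-2\}$, $p=m-k-1$ and $a\in\mathbb{R}^{k+1}$. If $\Sigma$ lies inside the closed cylinder $\overline{B^{k+1}(a,\sqrt{2(n-p)+|a|^2})}\times\mathbb{R}^p$, then $\Sigma\subset S^k(a,\sqrt{2(n-p)+|a|^2})\times\mathbb{R}^p$. Moreover, if in addition $n=m-1$, then $\Sigma=S^k(\sqrt{2k})\times\mathbb{R}^{n-k}$. 2. Let $k\in\{1,\ldots,n\}$ and $p=m-k-1$. For every $a\in\mathbb{R}^{k+1}$, $\Sigma$ cannot lie outside the closed cylinder $\overline{B^{k+1}(a,\sqrt{2(k+1)+|a|^2})}\times\mathbb{R}^p$; that is, $\Sigma$ is not contained in the complement of this closed cylinder in $\mathbb{R}^m$.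
   Context: An $n$-dimensional submanifold $\Sigma$ immersed in $\mathbb{R}^m$, $m>n$, is called a self-shrinker if $\mathbf{H}=-\frac12 X^N$, where $X$ is the position vector, $X^N$ is the component of $X$ normal to $\Sigma$, and $\mathbf{H}=\sum_{i=1}^n(\nabla_{E_i}E_i)^N$ is the mean curvature vector ($\{E_i\}$ a local orthonormal tangent frame of $\Sigma$, $\nabla$ the Euclidean connection), i.e. the trace of the second fundamental form. Inclusions and equalities of $\Sigma$ with subsets of $\mathbb{R}^m$ refer to the image of the immersion. Notation: $B^{k+1}(a,R)\subset\mathbb{R}^{k+1}$ is the (open) ball with center $a$ and radius $R$, $\overline{A}$ is the closure of $A$, $S^k(a,R)\subset\mathbb{R}^{k+1}$ is the $k$-dimensional sphere with center $a$ and radius $R$, $S^k(R)$ is the one centered at the origin, and $\mathbb{R}^m=\mathbb{R}^{k+1}\times\mathbb{R}^p$. *)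

(* Defs.v *)
From HB Require Import structures.
From mathcomp Require Export all_boot all_order all_algebra.
From mathcomp Require Export all_classical all_reals all_analysis.

Set Implicit Arguments.
Unset Strict Implicit.
Unset Printing Implicit Defensive.

Export Order.TTheory GRing.Theory Num.Theory.
Export numFieldNormedType.Exports.
Global Open Scope classical_set_scope.
Global Open Scope ring_scope.

(* The library norm `|x| on 'rV[R]_n is the sup norm; it is used only through
   the topology it induces.  Euclidean lengths are given by [enorm]. *)
Definition edot (R : realType) (n : nat) (u v : 'rV[R]_n) : R :=
  \sum_(i < n) u 0 i * v 0 i.

Definition enorm (R : realType) (n : nat) (u : 'rV[R]_n) : R :=
  Num.sqrt (edot u u).

Definition eball (R : realType) (n : nat) (a : 'rV[R]_n) (r : R) :
  set 'rV[R]_n := [set y | enorm (y - a) < r].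

Definition esphere (R : realType) (n : nat) (a : 'rV[R]_n) (r : R) :
  set 'rV[R]_n := [set y | enorm (y - a) = r].

(* A x R^p as a subset of R^m = R^d x R^p: the first d coordinates lie in A. *)
Definition cylinder (R : realType) (d p m : nat) (dpm : (d + p)%N = m)
    (A : set 'rV[R]_d) : set 'rV[R]_m :=
  [set x | A (lsubmx (castmx (erefl 1%N, esym dpm) x))].

(* C^k and C^oo maps on a set A, which is open in all uses. *)
Fixpoint Ck_on (R : realType) (V W : normedModType R) (k : nat) (A : set V)
    (f : V -> W) : Prop :=
  match k with
  | 0 => forall x, A x -> {for x, continuous f}
  | k'.+1 => (forall x, A x -> differentiable f x) /\
             (forall v, Ck_on k' A (fun x => 'D_v f x))
  end.

Definition smooth_on (R : realType) (V W : normedModType R) (A : set V)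
  (f : V -> W) : Prop := forall k, Ck_on k A f.

(* The values of [chart_map] outside [chart_dom], and those of [chart_inv]
   outside the image of [chart_map], are irrelevant. *)
Record chart (R : realType) (n : nat) (M : topologicalType) := Chart {
  chart_dom : set M;
  chart_map : M -> 'rV[R]_n;
  chart_inv : 'rV[R]_n -> M;
  chart_dom_open : open chart_dom;
  chart_cod_open : open (chart_map @` chart_dom);
  chart_mapK : forall q, chart_dom q -> chart_inv (chart_map q) = q;
  chart_map_continuous : forall q, chart_dom q -> {for q, continuous chart_map};
  chart_inv_continuous : forall x, (chart_map @` chart_dom) x ->
    {for x, continuous chart_inv}
}.

Definition chart_cod (R : realType) (n : nat) (M : topologicalType)
  (c : chart R n M) : set 'rV[R]_n := chart_map c @` chart_dom c.

(* Charts are modelled on open subsets of R^n, so there is no boundary. *)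
Record smooth_manifold (R : realType) (n : nat) := SmoothManifold {
  carrier :> topologicalType;
  atlas : set (chart R n carrier);
  manifold_hausdorff : hausdorff_space carrier;
  manifold_second_countable : @second_countable carrier;
  atlas_cover : forall q : carrier, exists2 c, atlas c & chart_dom c q;
  atlas_compatible : forall c c', atlas c -> atlas c' ->
    smooth_on (chart_map c @` (chart_dom c `&` chart_dom c'))
              (chart_map c' \o chart_inv c)
}.

Arguments atlas {R n} s _.

Section Immersions.
Variables (R : realType) (n m : nat) (M : smooth_manifold R n).
Implicit Types (X : M -> 'rV[R]_m) (Y : 'rV[R]_n -> 'rV[R]_m).

Definition immersion X : Prop :=
  forall c, atlas M c ->
    smooth_on (chart_cod c) (X \o chart_inv c) /\
    (forall x, chart_cod c x -> injective ('d (X \o chart_inv c) x)).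

Definition properly_immersed X : Prop :=
  immersion X /\
  (forall K : set 'rV[R]_m, compact K -> compact (X @^-1` K)).

Definition smooth_curve (g : R -> M) : Prop :=
  continuous g /\
  (forall c, atlas M c ->
    smooth_on (V := R^o) (g @^-1` chart_dom c) (chart_map c \o g)).

Definition curve_length X (g : R -> M) : \bar R :=
  (\int[lebesgue_measure]_(t in `[0%R, 1%R])
     (enorm (derive1 (X \o g) t))%:E)%E.

(* Riemannian distance; +oo between distinct connected components.  Smooth
   and piecewise C^1 curves give the same infimum, since a curve can be
   reparametrized so as to stop at its corners and endpoints. *)
Definition intrinsic_dist X (q q' : M) : \bar R :=
  ereal_inf [set curve_length X g | g in
    [set g | [/\ smooth_curve g, g 0 = q & g 1 = q']]].

Definition complete_immersed X : Prop :=
  forall u : nat -> M,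
    (forall e : R, 0 < e -> exists N : nat, forall i j : nat,
       (N <= i)%N -> (N <= j)%N -> (intrinsic_dist X (u i) (u j) < e%:E)%E) ->
    exists q, (fun i => intrinsic_dist X (u i) q) @ \oo --> 0%E.

(* Below, Y is an immersion of an open subset of R^n, namely X read in a
   chart.  The tangent space of Y at x is the row space of 'J Y x, and the
   normal space, its Euclidean orthogonal, is kermx ('J Y x)^T. *)
Definition normal_part Y (x : 'rV[R]_n) (v : 'rV[R]_m) : 'rV[R]_m :=
  v *m proj_mx (kermx ('J Y x)^T) <<'J Y x>>%MS.

(* The i-th field of the frame is E_i = dY(e i), where e i is a field on the
   parameter domain W. *)
Definition orthonormal_frame_on Y (W : set 'rV[R]_n)
    (e : 'I_n -> 'rV[R]_n -> 'rV[R]_n) : Prop :=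
  (forall i, smooth_on W (e i)) /\
  (forall x, W x -> forall i j,
     edot ('D_(e i x) Y x) ('D_(e j x) Y x) = (i == j)%:R).

(* h is the mean curvature vector of Y at x:  h = \sum_i (nabla_{E_i} E_i)^N,
   where nabla_{E_i} E_i is the derivative of the R^m-valued map E_i along
   the parameter direction e i x. *)
Definition is_mean_curvature (U : set 'rV[R]_n) Y (x : 'rV[R]_n)
    (h : 'rV[R]_m) : Prop :=
  exists (W : set 'rV[R]_n) (e : 'I_n -> 'rV[R]_n -> 'rV[R]_n),
    [/\ open W, W x, W `<=` U, orthonormal_frame_on Y W e &
        h = \sum_(i < n)
              normal_part Y x ('D_(e i x) (fun y => 'D_(e i y) Y y) x)].

Definition self_shrinker X : Prop :=
  forall c, atlas M c -> forall x, chart_cod c x ->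
    let Y := X \o chart_inv c in
    is_mean_curvature (chart_cod c) Y x (- 2^-1 *: normal_part Y x (Y x)).

End Immersions.

(* Main.v *)
Require Import Defs.
From mathcomp Require Import ring lra zify.

(** Write [x] for the first [k + 1] coordinates of the position vector [X], [y]
    for the other ones, and [L f = Lap f - <X, grad f> / 2] for the drift
    Laplacian of the self-shrinker. The shrinker equation says that every
    coordinate function satisfies [L X_j = - X_j / 2]. For every [a] this gives
      [L |x - 2 a|^2 = 2 |grad x|^2 - |x - a|^2 + |a|^2],
    where [|grad x|^2] is the sum of the squared tangential gradients of the
    coordinates in [x]. The gradients of all [m] coordinates contribute [n] in
    total and each of them at most 1, so [n - p <= |grad x|^2 <= k + 1]. The
    centre [2 a], instead of [a], is what makes the right-hand side depend on
    [|x - a|] only: it is nonnegative inside the first cylinder and negative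
    outside the second one.

    Both parts thus follow from a Liouville property ([subharmonic_near_cst]): a
    function of the position that is bounded above and satisfies [L f >= 0] is
    locally constant. Then [L f = 0], which is absurd outside the second
    cylinder and says [|x - a| = r] inside the first one. To prove it, note that
    [L |X|^2 = 2 n - |X|^2] and that [X] is proper, so on each component
    [f - e |X|^2] attains its maximum, at a point of the compact set
    [|X|^2 <= 2 n]. Letting [e] tend to 0, [f] attains its maximum on the
    component ([subharmonic_max]), and the strong maximum principle
    ([strong_max]) makes the set of maximum points open. Its barrier is a
    polynomial in the squared distance from a point of the ambient space.

    No Laplacian is formed. At a local maximum of [f] on the self-shrinker there
    is an orthonormal tangent frame [E] with
      [\sum_i Hess f (E i, E i) <= <grad f, X> / 2]
    and [grad f] normal to every [E i] ([frame_max]); this second derivative test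
    is the only way in which the shrinker equation is used.

    Let finally [n = m - 1] in the first part. Both [|x - a|^2] and
    [|x - 2 a|^2] are locally constant, so [<a, x>] is locally constant, so it
    vanishes because [L <a, x> = - <a, x> / 2]; hence [|x|^2 = 2 k]. Every point
    [(xP, yP)] of this cylinder is reached, since the maximum of
    [- |x - xP|^2 - c |y - yP|^2] can only be attained there
    ([hypersurface_onto]). *)

Set Implicit Arguments.
Unset Strict Implicit.
Unset Printing Implicit Defensive.

(** * Euclidean geometry of row vectors *)

Section Edot.
Variables (R : realType) (m : nat).
Implicit Types u v b : 'rV[R]_m.

Lemma edotE u v : edot u v = (u *m v^T) 0 0.
Proof. by rewrite mxE; apply: eq_bigr => i _; rewrite mxE. Qed.

Lemma edotC u v : edot u v = edot v u.
Proof. by apply: eq_bigr => i _; rewrite mulrC. Qed.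

Lemma edotDl u v b : edot (u + v) b = edot u b + edot v b.
Proof. by rewrite !edotE mulmxDl mxE. Qed.

Lemma edotZl c u b : edot (c *: u) b = c * edot u b.
Proof. by rewrite !edotE -scalemxAl mxE. Qed.

Lemma edotBl u v b : edot (u - v) b = edot u b - edot v b.
Proof. by rewrite edotDl -scaleN1r edotZl mulN1r. Qed.

Lemma edotDr b u v : edot b (u + v) = edot b u + edot b v.
Proof. by rewrite edotC edotDl !(edotC b). Qed.

Lemma edotZr b c u : edot b (c *: u) = c * edot b u.
Proof. by rewrite edotC edotZl edotC. Qed.

Lemma edotBr b u v : edot b (u - v) = edot b u - edot b v.
Proof. by rewrite edotC edotBl !(edotC b). Qed.

Lemma edot0l u : edot 0 u = 0.
Proof. by rewrite edotE mul0mx mxE. Qed.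

Lemma edotBB u v :
  edot (u - v) (u - v) = edot u u - 2 * edot u v + edot v v.
Proof. by rewrite edotBl !edotBr (edotC v u); ring. Qed.

(** The ball with diameter [a, b] meets the sphere about [a] through [b] only at
    [b]: if [c] is at least as far from [a] as [b] is, then [c] lies outside
    that ball, and [c = b] if it lies on its boundary. *)
Lemma edot_midpoint a b c (p := 2^-1 *: (a + b)) :
  2 * (edot (c - p) (c - p) - edot (b - p) (b - p)) =
  edot (c - a) (c - a) - edot (b - a) (b - a) + edot (c - b) (c - b).
Proof.
rewrite !edotBB /p !(edotZl, edotZr, edotDl, edotDr) (edotC b a); lra.
Qed.

Lemma edot_suml (I : Type) (s : seq I) (F : I -> 'rV[R]_m) b :
  edot (\sum_(i <- s) F i) b = \sum_(i <- s) edot (F i) b.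
Proof. by rewrite edotE mulmx_suml summxE; apply: eq_bigr => i _; rewrite edotE. Qed.

Lemma edot_sumr (I : Type) (s : seq I) (F : I -> 'rV[R]_m) b :
  edot b (\sum_(i <- s) F i) = \sum_(i <- s) edot b (F i).
Proof. by rewrite edotC edot_suml; apply: eq_bigr => i _; rewrite edotC. Qed.

Lemma edot_ge0 u : 0 <= edot u u.
Proof. by apply: sumr_ge0 => i _; rewrite -expr2 sqr_ge0. Qed.

Lemma edot_sqr_le u i : u 0 i ^+ 2 <= edot u u.
Proof.
rewrite /edot (bigD1 i)//= -expr2 lerDl sumr_ge0// => j _.
by rewrite -expr2 sqr_ge0.
Qed.

Lemma edot_eq0 u : (edot u u == 0) = (u == 0).
Proof.
apply/eqP/eqP => [u0|->]; last by rewrite edotE mul0mx mxE.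
apply/rowP => i; rewrite mxE; apply/eqP; rewrite -sqrf_eq0 eq_le sqr_ge0 andbT.
by rewrite -u0 edot_sqr_le.
Qed.

Lemma edot_gt0 u : (0 < edot u u) = (u != 0).
Proof. by rewrite lt0r edot_eq0 edot_ge0 andbT. Qed.

Lemma edot_CauchySchwarz u v : edot u v ^+ 2 <= edot u u * edot v v.
Proof.
have [->|v0] := eqVneq v 0.
  by rewrite !(edotC _ 0) -(scale0r 0) !edotZl !mul0r mulr0 expr0n.
have := edot_ge0 (edot v v *: u - edot u v *: v).
rewrite !(edotBl, edotBr, edotZl, edotZr) (edotC v u).
move: v0; rewrite -edot_gt0; set a := edot u u; set c := edot u v.
set d := edot v v => d0.
rewrite (_ : _ - _ = d * (a * d - c ^+ 2)); last by ring.
by rewrite pmulr_rge0// subr_ge0.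
Qed.

Lemma enorm_sqr u : enorm u ^+ 2 = edot u u.
Proof. by rewrite /enorm sqr_sqrtr// edot_ge0. Qed.

Lemma edot_delta u i : edot u (delta_mx 0 i) = u 0 i.
Proof.
rewrite /edot (bigD1 i)//= mxE !eqxx mulr1 big1 ?addr0// => j ji.
by rewrite mxE eqxx (negPf ji) mulr0.
Qed.

End Edot.

Definition orthonormal (R : realType) (m n : nat) (E : 'I_n -> 'rV[R]_m) :=
  forall i j, edot (E i) (E j) = (i == j)%:R.

Section Orthonormal.
Variables (R : realType) (m n : nat) (E : 'I_n -> 'rV[R]_m).
Hypothesis onE : orthonormal E.

Lemma edot_comb (c d : 'I_n -> R) :
  edot (\sum_i c i *: E i) (\sum_i d i *: E i) = \sum_i c i * d i.
Proof.
rewrite edot_suml; apply: eq_bigr => i _; rewrite edotZl; congr (_ * _).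
rewrite edot_sumr (bigD1 i)//= edotZr onE eqxx mulr1 big1 ?addr0// => j ji.
by rewrite edotZr onE eq_sym (negPf ji) mulr0.
Qed.

Lemma bessel b : \sum_i edot b (E i) ^+ 2 <= edot b b.
Proof.
pose p := \sum_i edot b (E i) *: E i.
have bp : edot b p = \sum_i edot b (E i) ^+ 2.
  by rewrite edot_sumr; apply: eq_bigr => i _; rewrite edotZr.
have pp : edot p p = \sum_i edot b (E i) ^+ 2.
  by rewrite edot_comb; apply: eq_bigr => i _; rewrite expr2.
have := edot_ge0 (b - p); rewrite edotBl !edotBr (edotC p b) pp bp.
by rewrite subrr subr0 subr_ge0.
Qed.

Lemma sum_coord_sqr_le1 j : \sum_i E i 0 j ^+ 2 <= 1.
Proof.
have := bessel (delta_mx 0 j); rewrite edot_delta mxE !eqxx.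
by under eq_bigr do rewrite edotC edot_delta.
Qed.

Lemma sum_coord_sqr : \sum_j \sum_i E i 0 j ^+ 2 = n%:R.
Proof.
rewrite exchange_big/= -[n in RHS]card_ord -sumr_const; apply: eq_bigr => i _.
have <- : edot (E i) (E i) = 1 by rewrite onE eqxx.
by apply: eq_bigr => j _; rewrite expr2.
Qed.

(** Cauchy-Schwarz against the orthogonal projection of [b] to the span of [E]. *)
Lemma edot_span_le b (c : 'I_n -> R) (u := \sum_i c i *: E i) :
  edot b u ^+ 2 <= edot u u * \sum_i edot b (E i) ^+ 2.
Proof.
have -> : edot b u = edot (\sum_i edot b (E i) *: E i) u.
  by rewrite edot_comb edot_sumr; apply: eq_bigr => i _; rewrite edotZr mulrC.
have -> : \sum_i edot b (E i) ^+ 2 =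
    edot (\sum_i edot b (E i) *: E i) (\sum_i edot b (E i) *: E i).
  by rewrite edot_comb; apply: eq_bigr => i _; rewrite expr2.
by rewrite mulrC edot_CauchySchwarz.
Qed.

End Orthonormal.

(** The orthogonal complement of [n] independent vectors of an [n + 1]-dimensional
    space is a line. *)
Lemma normal_line (R : realType) (n : nat) (E : 'I_n -> 'rV[R]_n.+1) (b d : 'rV[R]_n.+1) :
  orthonormal E -> (forall i, edot b (E i) = 0) -> (forall i, edot d (E i) = 0) ->
  b != 0 -> exists l, d = l *: b.
Proof.
move=> onE bE dE b0.
pose F := \matrix_i E i.
have rF : \rank F = n.
  apply/eqP; rewrite eqn_leq rank_leq_row/=.
  have FF : F *m F^T = 1%:M.
    by apply/matrixP => i j; rewrite !mxE -onE; apply: eq_bigr => k _; rewrite !mxE.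
  by have := mxrankM_maxl F F^T; rewrite FF mxrank1.
have kE c : (forall i, edot c (E i) = 0) -> (c <= kermx F^T)%MS.
  move=> cE; apply/sub_kermxP/rowP => i; rewrite !mxE -[RHS](cE i).
  by apply: eq_bigr => k _; rewrite !mxE.
have rk : \rank (kermx F^T) = 1%N by rewrite mxrank_ker mxrank_tr rF subSnn.
have bk : (kermx F^T <= b)%MS.
  rewrite -(geq_leqif (mxrank_leqif_sup (kE _ bE))) rk.
  by rewrite rank_rV b0.
by have /sub_rVP[l ->] := submx_trans (kE _ dE) bk; exists l.
Qed.

Section NormalPart.
Variables (R : realType) (n m : nat) (Y : 'rV[R]_n -> 'rV[R]_m) (x : 'rV[R]_n).
Let J := 'J Y x.

Lemma cap_normal_tangent : (kermx J^T :&: <<J>> = 0)%MS.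
Proof.
apply/eqP/rowV0P => w; rewrite sub_capmx genmxE => /andP[/sub_kermxP wk].
move=> /submxP[D wD]; apply/eqP; rewrite -edot_eq0 edotE {2}wD trmx_mul mulmxA.
by rewrite wk mul0mx mxE.
Qed.

Lemma sum_normal_tangent : (1%:M <= kermx J^T + <<J>>)%MS.
Proof.
rewrite sub1mx /row_full mxrank_disjoint_sum ?cap_normal_tangent//.
by rewrite mxrank_ker mxrank_tr genmxE subnK// rank_leq_col.
Qed.

(** A normal vector [b] does not see the tangential part of [w], so the normal
    projection disappears once it is paired with [b]. *)
Lemma edot_normal_part b w : b *m J^T = 0 ->
  edot b (normal_part Y x w) = edot b w.
Proof.
move=> bJ; rewrite /normal_part -/J.
have := @add_proj_mx _ _ _ _ _ w cap_normal_tangent.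
move=> /(_ (submx_trans (submx1 _) sum_normal_tangent)) {2}<-.
rewrite edotDr [X in _ + X](_ : _ = 0) ?addr0//.
have : (w *m proj_mx <<J>> (kermx J^T) <= J)%MS.
  by have := proj_mx_sub <<J>>%MS (kermx J^T) w; rewrite genmxE.
by move=> /submxP[D ->]; rewrite edotE trmx_mul mulmxA bJ mul0mx mxE.
Qed.

End NormalPart.

(** * Second-order jets of functions along curves *)

(** [f] has value [a0], first derivative [a1] and second derivative [a2] at 0.
    The first derivative is needed near 0 for the second one to make sense. *)
Definition jet2 (R : realType) (f : R -> R) (a0 a1 a2 : R) : Prop :=
  f 0 = a0 /\ exists f1 : R -> R,
    [/\ f1 0 = a1, \forall t \near (0 : R), is_derive (t : R) 1 f (f1 t)
      & is_derive (0 : R) 1 f1 a2].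

Section Jets.
Variable R : realType.
Implicit Types f g : R -> R.

Lemma jet2_cst (c : R) : jet2 (fun=> c) c 0 0.
Proof.
split=> //; exists (fun=> 0); split=> //; last exact: is_derive_cst.
by near=> t; exact: is_derive_cst.
Unshelve. all: by end_near. Qed.

Lemma jet2D f g a0 a1 a2 b0 b1 b2 : jet2 f a0 a1 a2 -> jet2 g b0 b1 b2 ->
  jet2 (fun t => f t + g t) (a0 + b0) (a1 + b1) (a2 + b2).
Proof.
move=> [<- [f1 [<- nf1 df1]]] [<- [g1 [<- ng1 dg1]]]; split=> //.
exists (fun t => f1 t + g1 t); split=> //; last exact: is_deriveD.
near=> t; apply: is_deriveD; first by near: t.
by near: t.
Unshelve. all: by end_near. Qed.

Lemma jet2M f g a0 a1 a2 b0 b1 b2 : jet2 f a0 a1 a2 -> jet2 g b0 b1 b2 ->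
  jet2 (fun t => f t * g t) (a0 * b0) (a1 * b0 + a0 * b1)
    (a2 * b0 + 2 * (a1 * b1) + a0 * b2).
Proof.
move=> [<- [f1 [<- nf1 df1]]] [<- [g1 [<- ng1 dg1]]]; split=> //.
exists (fun t => f1 t * g t + f t * g1 t); split=> //.
  near=> t.
  have df : is_derive (t : R) 1 f (f1 t) by near: t.
  have dg : is_derive (t : R) 1 g (g1 t) by near: t.
  by apply: is_derive_eq; rewrite /GRing.scale/=; ring.
have df : is_derive (0 : R) 1 f (f1 0) := nbhs_singleton nf1.
have dg : is_derive (0 : R) 1 g (g1 0) := nbhs_singleton ng1.
by apply: is_derive_eq; rewrite /GRing.scale/=; ring.
Unshelve. all: by end_near. Qed.

Lemma jet2_sum (I : Type) (s : seq I) (f a0 a1 a2 : I -> _) :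
  (forall i, jet2 (f i) (a0 i) (a1 i) (a2 i)) ->
  jet2 (fun t : R => \sum_(i <- s) f i t) (\sum_(i <- s) a0 i)
    (\sum_(i <- s) a1 i) (\sum_(i <- s) a2 i).
Proof.
move=> h; elim: s => [|i s ih].
  rewrite !big_nil; rewrite (_ : (fun _ => _) = fun=> 0); first exact: jet2_cst.
  by apply/funext => t; rewrite big_nil.
rewrite !big_cons (_ : (fun _ => _) = fun t => f i t + \sum_(i <- s) f i t).
  exact: jet2D.
by apply/funext => t; rewrite big_cons.
Qed.

Lemma jet2_eq f a0 a1 a2 b0 b1 b2 : jet2 f a0 a1 a2 ->
  a0 = b0 -> a1 = b1 -> a2 = b2 -> jet2 f b0 b1 b2.
Proof. by move=> + <- <- <-. Qed.

(** If [a1 = 0 < a2] then the first derivative is positive on some interval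
    to the right of 0, where [f] would exceed [f 0]. *)
Lemma jet2_max f a0 a1 a2 : jet2 f a0 a1 a2 ->
  (\forall t \near (0 : R), f t <= f 0) -> a1 = 0 /\ a2 <= 0.
Proof.
move=> [_ [f1 [<- nf1 df1]]] fmax.
have /nbhs_ballP[e /= e0 eB] : \forall t \near (0 : R),
  is_derive (t : R) 1 f (f1 t) /\ f t <= f 0.
  by near=> t; split; near: t.
have inB t : `|t| < e -> is_derive (t : R) 1 f (f1 t) /\ f t <= f 0.
  by move=> te; apply: eB; rewrite -ball_normE /= sub0r normrN.
have f10 : f1 0 = 0.
  have : is_derive (0 : R) 1 f 0.
    apply: (@derive1_at_max _ f (- e) e 0); rewrite ?in_itv/= ?oppr_lt0 ?e0//.
      by rewrite (le_trans _ (ltW e0))// oppr_le0 ltW.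
      move=> t; rewrite in_itv/= -ltr_norml => /inB[df _]; exact: ex_derive.
    by move=> t; rewrite in_itv/= -ltr_norml => /inB[].
  have n0e : `|0 : R| < e by rewrite normr0.
  have [d1 _] := inB 0 n0e.
  by move=> d0; have := @derive_val _ _ _ _ _ _ _ d1; rewrite derive_val.
split=> //; rewrite leNgt; apply/negP => a20.
have : (fun h => h^-1 *: (f1 (h *: 1 + 0) - f1 0)) @ 0^' --> a2.
  by have [df1' <-] := df1; exact: df1'.
move=> /cvgr_gt => /(_ 0 a20); rewrite near_withinE => /nbhs_ballP[d /= d0 dB].
have f1pos t : 0 < t -> t < d -> 0 < f1 t.
  move=> t0 td; have := dB t; rewrite -ball_normE /= sub0r normrN gtr0_norm//.
  move=> /(_ td (lt0r_neq0 t0)).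
  by rewrite f10 subr0 addr0 [_%:A]mulr1 pmulr_rgt0 ?invr_gt0.
pose s := Num.min e d / 2.
have s0 : 0 < s by rewrite divr_gt0// lt_min e0.
have sed : s < Num.min e d by rewrite ltr_pdivrMr// ltr_pMr ?lt_min ?e0// ltr1n.
have [se sd] : s < e /\ s < d by apply/andP; rewrite -lt_min.
have dfs t : 0 <= t <= s -> is_derive (t : R) 1 f (f1 t).
  by move=> /andP[t0 ts]; have [] := inB t; rewrite ?ger0_norm// (le_lt_trans ts).
have [||c] := @MVT _ f f1 0 s s0.
- by move=> t; rewrite in_itv/= => /andP[t0 ts]; apply: dfs; rewrite !ltW.
- apply: derivable_within_continuous => t; rewrite in_itv/= => ts.
  by apply: ex_derive; exact: dfs.
rewrite in_itv/= subr0 => /andP[c0 cs] fs.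
have : f s <= f 0 by have [] := inB s; rewrite ?gtr0_norm.
rewrite -subr_le0 fs leNgt mulr_gt0// f1pos//; exact: lt_trans cs sd.
Unshelve. all: by end_near. Qed.

End Jets.

Section Jet2At.
Variables (R : realType) (m : nat).
Implicit Types (f g : 'rV[R]_m -> R) (P G : 'rV[R]_m) (Q : 'rV[R]_m -> R).

(** [f] has gradient [G] and Hessian quadratic form [Q] at [P], in the form of a
    second-order chain rule along curves through [P]. *)
Definition jet2_at f P G Q : Prop :=
  forall (c : R -> 'rV[R]_m) (E A : 'rV[R]_m),
    (forall j, jet2 (fun t => c t 0 j) (P 0 j) (E 0 j) (A 0 j)) ->
    jet2 (f \o c) (f P) (edot G E) (Q E + edot G A).

Lemma jet2_at_eq f P G1 G2 Q1 Q2 : jet2_at f P G1 Q1 -> G1 = G2 -> Q1 =1 Q2 ->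
  jet2_at f P G2 Q2.
Proof. by move=> h <- Q12 c E A /h; rewrite Q12. Qed.

Lemma jet2_at_cst (k : R) P : jet2_at (fun=> k) P 0 (fun=> 0).
Proof.
move=> c E A _; apply: jet2_eq (jet2_cst k) _ _ _ => //.
  by rewrite edotE mul0mx mxE.
by rewrite edotE mul0mx mxE addr0.
Qed.

Lemma jet2_atD f1 f2 P G1 G2 Q1 Q2 : jet2_at f1 P G1 Q1 -> jet2_at f2 P G2 Q2 ->
  jet2_at (fun X => f1 X + f2 X) P (G1 + G2) (fun E => Q1 E + Q2 E).
Proof.
move=> h1 h2 c E A cEA; apply: jet2_eq (jet2D (h1 _ _ _ cEA) (h2 _ _ _ cEA)) _ _ _ => //.
  by rewrite edotDl.
by rewrite edotDl addrACA.
Qed.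

Lemma jet2_atM f1 f2 P G1 G2 Q1 Q2 : jet2_at f1 P G1 Q1 -> jet2_at f2 P G2 Q2 ->
  jet2_at (fun X => f1 X * f2 X) P (f2 P *: G1 + f1 P *: G2)
    (fun E => f2 P * Q1 E + 2 * (edot G1 E * edot G2 E) + f1 P * Q2 E).
Proof.
move=> h1 h2 c E A cEA; apply: jet2_eq (jet2M (h1 _ _ _ cEA) (h2 _ _ _ cEA)) _ _ _ => //.
  by rewrite edotDl !edotZl; ring.
by rewrite edotDl !edotZl; ring.
Qed.

Lemma jet2_atZ k f P G Q : jet2_at f P G Q ->
  jet2_at (fun X => k * f X) P (k *: G) (fun E => k * Q E).
Proof.
move=> h; have /= kh := jet2_atM (@jet2_at_cst k P) h; apply: jet2_at_eq kh _ _.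
  by rewrite scaler0 add0r.
by move=> E /=; rewrite !edotE mul0mx !mxE; ring.
Qed.

Definition diag_quad (al be : 'rV[R]_m) (X : 'rV[R]_m) : R :=
  \sum_j (al 0 j * X 0 j ^+ 2 + be 0 j * X 0 j).

Lemma jet2_at_diag_quad al be P :
  jet2_at (diag_quad al be) P (\row_j (2 * al 0 j * P 0 j + be 0 j))
    (fun E => \sum_j 2 * al 0 j * E 0 j ^+ 2).
Proof.
move=> c E A cEA.
have h j := jet2D (jet2M (jet2_cst (al 0 j)) (jet2M (cEA j) (cEA j)))
  (jet2M (jet2_cst (be 0 j)) (cEA j)).
apply: jet2_eq (jet2_sum (index_enum _) h) _ _ _.
- by apply: eq_bigr => j _; rewrite expr2.
- by apply: eq_bigr => j _; rewrite mxE; ring.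
- by rewrite -big_split; apply: eq_bigr => j _; rewrite mxE /=; ring.
Qed.

End Jet2At.

Section DerivRow.
Variables (R : realType) (V : normedModType R).

Lemma is_derive_rowP m (F : V -> 'rV[R]_m) (x v : V) (a : 'rV[R]_m) :
  is_derive x v F a <-> forall l, is_derive x v (fun y => F y 0 l) (a 0 l).
Proof.
split=> [[dF <-] l|h].
  apply: DeriveDef; first exact: (derivable_mxP _ _ _).1.
  by rewrite derive_mx// mxE.
have dF : derivable F x v.
  by apply/derivable_mxP => i j; rewrite ord1; exact: ex_derive.
apply: DeriveDef => //; apply/rowP => l; rewrite derive_mx// mxE.
by have [_ ->] := h l.
Qed.

Lemma is_derive_sumf (W : normedModType R) (n : nat) (h : 'I_n -> V -> W)
    (x v : V) (dh : 'I_n -> W) :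
  (forall j, is_derive x v (h j) (dh j)) ->
  is_derive x v (fun y => \sum_j h j y) (\sum_j dh j).
Proof.
move=> hd; rewrite (_ : (fun _ => _) = \sum_j h j).
  by apply: is_derive_sum.
by apply/funext => y; rewrite fct_sumE.
Qed.

(** Both difference quotients are the same function. *)
Lemma is_derive_line (W : normedModType R) (f : V -> W) (x v : V) (t : R) (a : W) :
  is_derive (x + t *: v) v f a -> is_derive t 1 (fun s => f (x + s *: v)) a.
Proof.
have E : (fun h : R => h^-1 *: (((fun s => f (x + s *: v)) \o shift t) (h *: 1)
     - f (x + t *: v))) =
   (fun h => h^-1 *: ((f \o shift (x + t *: v)) (h *: v) - f (x + t *: v))).
  apply/funext => h; rewrite /=; congr (_ *: (_ - _)); congr (f _).
  by rewrite [h%:A]mulr1 scalerDl addrCA.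
move=> [d <-]; apply: DeriveDef; first by rewrite /derivable E; exact: d.
by rewrite /derive E.
Qed.

Lemma near_line (x v : V) (U : set V) : nbhs x U ->
  \forall t \near (0 : R), U (x + t *: v).
Proof.
move=> Ux.
have : (fun t : R => x + t *: v) @ (0 : R) --> x.
  rewrite -[X in _ --> X]addr0 -(scale0r v).
  by apply: cvgD; [exact: cvg_cst|exact: scalel_continuous].
exact.
Qed.

End DerivRow.

(** * The second derivative test on a self-shrinker *)

Section Frame.
Variables (R : realType) (n m : nat).
Implicit Types (Y : 'rV[R]_n -> 'rV[R]_m) (U : set 'rV[R]_n).

(** The shrinker equation at one point, read with constant directions [v i] whose
    images are orthonormal: the trace of the second fundamental form and
    [- Y x / 2] have the same normal part. Testing against normal vectors [b]
    avoids the normal projection, and constant directions reduce later second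
    derivatives to functions of one variable. *)
Definition shrinker_frame Y (x : 'rV[R]_n) (v : 'I_n -> 'rV[R]_n) : Prop :=
  orthonormal (fun i => 'D_(v i) Y x) /\
  forall b : 'rV[R]_m, (forall i, edot b ('D_(v i) Y x) = 0) ->
    \sum_i edot b ('D_(v i) ('D_(v i) Y) x) = - 2^-1 * edot b (Y x).

Lemma derive_delta_sum Y x v : differentiable Y x ->
  'D_v Y x = \sum_j v 0 j *: 'D_(delta_mx 0 j) Y x.
Proof.
move=> dY; rewrite deriveE// {1}(row_sum_delta v) linear_sum.
by apply: eq_bigr => j _; rewrite linearZ/= deriveE.
Qed.

(** The vectors [v i] form a basis of the parameter space, since their images
    are orthonormal. *)
Lemma frame_span Y x (v : 'I_n -> 'rV[R]_n) w : differentiable Y x ->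
  orthonormal (fun i => 'D_(v i) Y x) ->
  exists c : 'I_n -> R, 'D_w Y x = \sum_i c i *: 'D_(v i) Y x.
Proof.
move=> dY onv; pose V := \matrix_i v i.
have VJ i : row i (V *m 'J Y x) = 'D_(v i) Y x.
  by rewrite deriveEjacobian// row_mul rowK.
have VV : V *m ('J Y x *m (V *m 'J Y x)^T) = 1%:M.
  rewrite mulmxA; apply/matrixP => i j.
  rewrite !mxE -onv -!VJ; apply: eq_bigr => k _.
  by rewrite !mxE.
exists (fun i => (w *m invmx V) 0 i).
have Vu : V \in unitmx by case/mulmx1_unit: VV.
rewrite deriveEjacobian// -[w in LHS](mulmxKV Vu) -(mulmxA _ V) mulmx_sum_row.
by apply: eq_bigr => i _; rewrite VJ.
Qed.

(** Replacing the field [e] by its value at [x] costs the term where [e] is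
    differentiated, and this term is tangent to the image of [Y]. *)
Lemma derive_frame_field U Y (W : set 'rV[R]_n) (e : 'rV[R]_n -> 'rV[R]_n) x :
  smooth_on U Y -> open W -> W x -> W `<=` U -> smooth_on W e ->
  'D_(e x) (fun y => 'D_(e y) Y y) x =
  'D_(e x) ('D_(e x) Y) x + 'D_('D_(e x) e x) Y x.
Proof.
move=> /(_ 2%N)[dY /= dDY] oW Wx WU /(_ 1%N)[de _].
set v := e x.
have Ux : U x by exact: WU.
have D2 w : is_derive x v (fun y => 'D_w Y y) ('D_v (fun y => 'D_w Y y) x).
  by apply/derivableP/diff_derivable; have [+ _] := dDY w; exact.
have D1 : is_derive x v e ('D_v e x) by apply/derivableP/diff_derivable/de.
have nearW : \forall y \near x, W y by exact: open_nbhs_nbhs.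
have E (f : 'rV[R]_n -> 'rV[R]_n) df : is_derive x v f df ->
    is_derive x v (fun y => 'D_(f y) Y y)
      (\sum_j (f x 0 j *: 'D_v ('D_(delta_mx 0 j) Y) x + df 0 j *: 'D_(delta_mx 0 j) Y x)).
  move=> /is_derive_rowP D1'.
  apply/is_derive_rowP => l.
  apply: (@near_eq_is_derive _ _ _
    (fun y => \sum_j f y 0 j * ('D_(delta_mx 0 j) Y y) 0 l)).
    near=> y; rewrite derive_delta_sum; last by apply/dY/WU; near: y.
    by rewrite summxE; apply: eq_bigr => j _; rewrite mxE.
  rewrite summxE; apply: is_derive_sumf => j.
  have /is_derive_rowP/(_ l) d2 := D2 (delta_mx 0 j).
  have d1 := D1' j.
  by apply: is_derive_eq; rewrite !mxE /GRing.scale/=; ring.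
have [_ ->] := E _ _ D1.
have [_ ->] := E (cst v) 0 (is_derive_cst _ _ _).
rewrite (derive_delta_sum _ (dY _ Ux)) -big_split; apply: eq_bigr => j _ /=.
by rewrite mxE scale0r addr0.
Unshelve. all: by end_near. Qed.

Lemma ex_shrinker_frame U Y x : smooth_on U Y -> U x ->
  is_mean_curvature U Y x (- 2^-1 *: normal_part Y x (Y x)) ->
  exists v, shrinker_frame Y x v.
Proof.
move=> sY Ux [W [e [oW Wx WU [se one] H]]].
have dY : differentiable Y x by have [+ _] := sY 1%N; exact.
exists (fun i => e i x); split=> [i j|b bE]; first exact: one.
have bJ : b *m ('J Y x)^T = 0.
  apply/rowP => j; have [w wE] := frame_span (delta_mx 0 j) dY (one x Wx).
  have -> : (b *m ('J Y x)^T) 0 j = edot b (row j ('J Y x)).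
    by rewrite mxE; apply: eq_bigr => l _; rewrite !mxE.
  rewrite rowE -deriveEjacobian// wE edot_sumr mxE big1// => i _.
  by rewrite edotZr bE mulr0.
have := congr1 (edot b) H.
rewrite edotZr edot_normal_part// => ->; rewrite edot_sumr.
apply: eq_bigr => i _; rewrite [RHS](edot_normal_part _ bJ).
rewrite (derive_frame_field sY oW Wx WU (se i)) edotDr [X in _ + X](_ : _ = 0) ?addr0//.
by rewrite deriveEjacobian// edotE trmx_mul mulmxA bJ mul0mx mxE.
Unshelve. all: by end_near. Qed.

Lemma jet2_line U Y x v : smooth_on U Y -> open U -> U x -> forall j,
  jet2 (fun t => Y (x + t *: v) 0 j) (Y x 0 j) ('D_v Y x 0 j) ('D_v ('D_v Y) x 0 j).
Proof.
move=> /(_ 2%N)[dY /(_ v)[dDY _]] oU Ux j; split; first by rewrite scale0r addr0.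
exists (fun t => 'D_v Y (x + t *: v) 0 j); split.
- by rewrite scale0r addr0.
- near=> t.
  have h : is_derive t 1 (fun s => Y (x + s *: v)) ('D_v Y (x + t *: v)).
    apply: is_derive_line.
    by apply/derivableP/diff_derivable/dY; near: t; apply: near_line; exact: open_nbhs_nbhs.
  exact: ((is_derive_rowP _ _ _ _).1 h).
- have h : is_derive (0 : R) 1 (fun s => 'D_v Y (x + s *: v)) ('D_v ('D_v Y) x).
    apply: (is_derive_line (f := 'D_v Y)).
    by rewrite scale0r addr0; apply/derivableP/diff_derivable/dDY.
  exact: ((is_derive_rowP _ _ _ _).1 h).
Unshelve. all: by end_near. Qed.

(** The second derivative test along each [v i]. At a maximum [G] is normal, so
    the shrinker equation turns the terms [G . D_(v i) (D_(v i) Y)] into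
    [- G . Y / 2]; the outcome says that the drift Laplacian of [f \o Y] is
    nonpositive at [x]. *)
Lemma frame_max U Y x v f G Q : smooth_on U Y -> open U -> U x ->
  shrinker_frame Y x v -> jet2_at f (Y x) G Q ->
  (\forall y \near x, f (Y y) <= f (Y x)) ->
  (forall i, edot G ('D_(v i) Y x) = 0) /\
  \sum_i Q ('D_(v i) Y x) <= 2^-1 * edot G (Y x).
Proof.
move=> sY oU Ux [onv curv] fG fmax.
have h i : edot G ('D_(v i) Y x) = 0 /\
    Q ('D_(v i) Y x) + edot G ('D_(v i) ('D_(v i) Y) x) <= 0.
  apply: (jet2_max (fG _ _ _ (jet2_line (v i) sY oU Ux))).
  by rewrite /= scale0r addr0; exact: near_line fmax.
split=> [i|]; first by have [] := h i.
have : \sum_i (Q ('D_(v i) Y x) + edot G ('D_(v i) ('D_(v i) Y) x)) <= 0.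
  by apply: sumr_le0 => i _; have [] := h i.
rewrite big_split/= curv; first by rewrite mulNr subr_le0.
by move=> i; have [] := h i.
Unshelve. all: by end_near. Qed.

End Frame.

(** * Continuous functions on compact sets and balls *)

Section ContinuousRow.
Variables (R : realType) (T : topologicalType).

Lemma continuous_sumf (I : Type) (s : seq I) (F : I -> T -> R) (y : T) :
  (forall i, {for y, continuous (F i)}) ->
  {for y, continuous (fun z => \sum_(i <- s) F i z)}.
Proof.
move=> h; elim: s => [|i s ih].
  rewrite (_ : (fun _ => _) = fun=> 0); first exact: cst_continuous.
  by apply/funext => z; rewrite big_nil.
rewrite (_ : (fun _ => _) = fun z => F i z + \sum_(j <- s) F j z).
  by apply: continuousD => //; exact: h.
by apply/funext => z; rewrite big_cons.
Qed.

Lemma continuous_coord m (F : T -> 'rV[R]_m) (y : T) j :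
  {for y, continuous F} -> {for y, continuous (fun z => F z 0 j)}.
Proof.
move=> cF; apply: (@continuous_comp _ _ _ F (fun X : 'rV[R]_m => X 0 j)) => //.
exact: coord_continuous.
Qed.

Lemma continuous_edot m (F G : T -> 'rV[R]_m) (y : T) :
  {for y, continuous F} -> {for y, continuous G} ->
  {for y, continuous (fun z => edot (F z) (G z))}.
Proof.
move=> cF cG; apply: continuous_sumf => i.
by apply: continuousM; exact: continuous_coord.
Qed.

End ContinuousRow.

Section CompactExtrema.
Variables (R : realType) (T : topologicalType) (K : set T).
Hypothesis cK : compact K.
Implicit Types f u h : T -> R.

Lemma compact_max f : K !=set0 -> (forall y, K y -> {for y, continuous f}) ->
  exists2 c, K c & forall y, K y -> f y <= f c.
Proof.
move=> K0 cf; have [|c Kc cmax] := @compact_EVT_max _ R f K K0 cK.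
  by apply: continuous_in_subspaceT => y; rewrite inE; exact: cf.
by exists c => [|y Ky]; [rewrite inE in Kc|apply: cmax; rewrite inE].
Qed.

Lemma compact_min f : K !=set0 -> (forall y, K y -> {for y, continuous f}) ->
  exists2 c, K c & forall y, K y -> f c <= f y.
Proof.
move=> K0 cf; have [|c Kc cmin] := @compact_EVT_min _ R f K K0 cK.
  by apply: continuous_in_subspaceT => y; rewrite inE; exact: cf.
by exists c => [|y Ky]; [rewrite inE in Kc|apply: cmin; rewrite inE].
Qed.

Lemma compact_pos_lb f : (forall y, K y -> {for y, continuous f}) ->
  (forall y, K y -> 0 < f y) -> exists2 a, 0 < a & forall y, K y -> a <= f y.
Proof.
move=> cf f0; have [->|/set0P K0] := eqVneq K set0; first by exists 1.
by have [c Kc cmin] := compact_min K0 cf; exists (f c); [exact: f0|].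
Qed.

(** By compactness [Num.max (u y) (- h y)] is bounded below by some [a > 0]: where
    [u] is at least [a] a small [e] suffices, and elsewhere [h] is negative. *)
Lemma compact_perturb u h : (forall y, K y -> {for y, continuous u}) ->
  (forall y, K y -> {for y, continuous h}) ->
  (forall y, K y -> 0 <= u y) -> (forall y, K y -> u y = 0 -> h y < 0) ->
  exists2 e, 0 < e & forall y, K y -> e * h y < u y.
Proof.
move=> cu ch u0 uh.
have [a a0 amin] : exists2 a, 0 < a & forall y, K y -> a <= Num.max (u y) (- h y).
  apply: compact_pos_lb => y Ky.
    by apply: continuous_max; [exact: cu|apply: continuousN; exact: ch].
  rewrite lt_max oppr_gt0; have [/uh -> //|un] := eqVneq (u y) 0; rewrite ?orbT//.
  by rewrite lt0r un u0.
have [K0|/set0P K0] := eqVneq K set0; first by exists 1 => // y; rewrite K0.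
have [c Kc cmax] := compact_max K0 ch.
have H0 : 0 < `|h c| + 1 by rewrite ltr_wpDl.
exists (a / (`|h c| + 1)) => [|y Ky]; first by rewrite divr_gt0.
have := amin y Ky; rewrite le_max => /orP[au|ah].
  apply: lt_le_trans au; rewrite mulrAC ltr_pdivrMr// ltr_pM2l//.
  by rewrite (le_lt_trans (cmax y Ky))// (le_lt_trans (ler_norm _))// ltrDl.
apply: lt_le_trans (u0 _ Ky); rewrite pmulr_rlt0 ?divr_gt0//.
by rewrite -oppr_gt0 (lt_le_trans a0).
Qed.

End CompactExtrema.

Lemma closed_level (R : realType) (T : topologicalType) (B : set T) (g : T -> R) a :
  closed B -> (forall y, B y -> {for y, continuous g}) ->
  closed (B `&` [set y | g y = a]).
Proof.
move=> cB cg y yBa; have By : B y.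
  by apply: cB; apply: closureS yBa; exact: subIsetl.
split=> //=; apply: contrapT => /eqP gya.
have : \forall z \near y, g z != a.
  have : \forall r \near g y, r != a by apply: open_nbhs_nbhs; split=> //; exact: open_neq.
  by move=> /(cg _ By).
by move=> /yBa[z [[_ /= ->]]]; rewrite eqxx.
Qed.

Section Balls.
Variables (R : realType) (n : nat) (x : 'rV[R]_n) (d : R).

Lemma compact_cball : compact [set y : 'rV[R]_n | `|y - x| <= d].
Proof.
apply: bounded_closed_compact.
  exists (`|x| + d); split=> [|M xM y /= yd]; first exact: num_real.
  by rewrite (le_trans _ (ltW xM))// -(subrK x y) addrC (le_trans (ler_normD _ _))// lerD2l.
have := @closed_closed_ball_ _ _ x d; rewrite /closed_ball_.
by under eq_set do rewrite distrC.
Qed.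

Lemma closed_cball : closed [set y : 'rV[R]_n | `|y - x| <= d].
Proof. by apply: compact_closed compact_cball; exact: norm_hausdorff. Qed.

Lemma compact_csphere : compact [set y : 'rV[R]_n | `|y - x| = d].
Proof.
have cn (y : 'rV[R]_n) : {for y, continuous (fun z : 'rV[R]_n => `|z - x|)}.
  apply: (@continuous_comp _ _ _ (fun z : 'rV[R]_n => z - x) (fun z => `|z|)).
    by apply: continuousB; [exact: cvg_id|exact: cst_continuous].
  exact: norm_continuous.
have -> : [set y : 'rV[R]_n | `|y - x| = d] =
    [set y | `|y - x| <= d] `&` [set y | `|y - x| = d].
  by apply/seteqP; split=> y /=; [move=> yd; split=> //; rewrite yd|case].
apply: (@subclosed_compact _ _ [set y : 'rV[R]_n | `|y - x| <= d]).
- by apply: closed_level => // ; exact: closed_cball.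
- exact: compact_cball.
- exact: subIsetl.
Qed.

Lemma near_cball (P : set 'rV[R]_n) : nbhs x P ->
  exists2 e, 0 < e & forall y, `|y - x| <= e -> P y.
Proof.
move=> /nbhs_ballP[e /= e0 eP]; exists (e / 2); first by rewrite divr_gt0.
move=> y ye; apply: eP; rewrite -ball_normE /= distrC (le_lt_trans ye)//.
by rewrite ltr_pdivrMr// ltr_pMr// ltr1n.
Qed.

Lemma near_ball : 0 < d -> \forall y \near x, `|y - x| < d.
Proof.
move=> d0; apply/nbhs_ballP; exists d => // y.
by rewrite -ball_normE /= distrC.
Qed.

End Balls.

(** * The strong maximum principle *)

Section Transversality.
Variable R : realType.

(** The squared Frobenius norm. *)
Definition frob2 (p q : nat) (A : 'M[R]_(p, q)) : R := \sum_j \sum_i A i j ^+ 2.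

Lemma edot_mulmx_le p q (v : 'rV[R]_p) (A : 'M[R]_(p, q)) :
  edot (v *m A) (v *m A) <= edot v v * frob2 A.
Proof.
rewrite /frob2 mulr_sumr; apply: ler_sum => j _; rewrite -expr2.
have -> : (v *m A) 0 j = edot v (row j A^T).
  by rewrite mxE; apply: eq_bigr => i _; rewrite !mxE.
apply: le_trans (edot_CauchySchwarz _ _) _; rewrite ler_wpM2l ?edot_ge0//.
by apply: ler_sum => i _; rewrite !mxE expr2.
Qed.

Lemma frob2_ge0 p q (A : 'M[R]_(p, q)) : 0 <= frob2 A.
Proof. by do 2!apply: sumr_ge0 => ? _; exact: sqr_ge0. Qed.

(** With [r = a - c] and [s = b - c], add up the inequalities
    [|2 r + c|^2 >= 0], [|2 s + c|^2 >= 0] and [|r + s|^2 >= 0]. *)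
Lemma edot_perturb_gt0 p (a b c : 'rV[R]_p) (e : R) :
  edot (a - c) (a - c) <= e -> edot (b - c) (b - c) <= e ->
  6 * e < edot c c -> 0 < edot a b.
Proof.
rewrite -[in edot a b](subrK c a) -[in edot _ b](subrK c b).
move: (a - c) (b - c) => r s re se ec.
have := edot_ge0 (2 *: s + c); have := edot_ge0 (2 *: r + c).
have := edot_ge0 (r + s).
rewrite !(edotDl, edotDr, edotZl, edotZr) (edotC c r) (edotC c s) (edotC s r).
by move: re se ec; set x1 := edot r r; set x2 := edot s s; lra.
Qed.

Variables (n m : nat) (U : set 'rV[R]_n) (Y : 'rV[R]_n -> 'rV[R]_m).
Hypotheses (oU : open U) (sY : smooth_on U Y).

Lemma smooth_diff y : U y -> differentiable Y y.
Proof. by have [+ _] := sY 1%N; exact. Qed.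

Lemma smooth_cont y : U y -> {for y, continuous Y}.
Proof. exact: (sY 0%N). Qed.

Lemma smooth_derive_cont v y : U y -> {for y, continuous (fun z => 'D_v Y z)}.
Proof. by have [_ +] := sY 1%N; apply. Qed.

Let Jac y : 'M[R]_(n, m) := \matrix_(i, j) 'D_(delta_mx 0 i) Y y 0 j.

Let deriveJac v y : U y -> 'D_v Y y = v *m Jac y.
Proof.
move=> Uy; rewrite (derive_delta_sum v (smooth_diff Uy)); apply/rowP => j.
by rewrite summxE mxE; apply: eq_bigr => i _; rewrite !mxE.
Qed.

(** The mean value theorem turns the right-hand factor into [dY (y - z)] at a
    third point, and both factors are close to [dY (y - z)] at [x]. *)
Lemma ex_transversal_ball x : U x -> injective ('d Y x) ->
  exists2 d, 0 < d & (forall y, `|y - x| <= d -> U y) /\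
    forall y z, `|y - x| <= d -> `|z - x| <= d -> y != z ->
      0 < edot ('D_(y - z) Y y) (Y y - Y z).
Proof.
move=> Ux injY.
have /row_freeP[T JT] : row_free (Jac x).
  rewrite -kermx_eq0; apply/eqP/row_matrixP => i; rewrite row0.
  apply: injY; rewrite linear0 -deriveE; last exact: smooth_diff.
  by rewrite deriveJac// -row_mul mulmx_ker row0.
pose t := frob2 T + 1.
have t0 : 0 < t by rewrite ltr_wpDl ?frob2_ge0.
have vJ v : edot v v <= edot (v *m Jac x) (v *m Jac x) * t.
  rewrite -[v in edot v v]mulmx1 -JT mulmxA (le_trans (edot_mulmx_le _ _))//.
  by rewrite ler_wpM2l ?edot_ge0// lerDl.
pose e := (12 * t)^-1.
have e0 : 0 < e by rewrite invr_gt0 mulr_gt0.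
have nJ : \forall y \near x, frob2 (Jac y - Jac x) < e.
  have c : {for x, continuous (fun y => frob2 (Jac y - Jac x))}.
    apply: continuous_sumf => j; apply: continuous_sumf => i.
    rewrite (_ : (fun _ => _) = fun y => ('D_(delta_mx 0 i) Y y 0 j - Jac x i j) *
      ('D_(delta_mx 0 i) Y y 0 j - Jac x i j)); last first.
      by apply/funext => y; rewrite !mxE expr2.
    have cc : {for x, continuous (fun y => 'D_(delta_mx 0 i) Y y 0 j - Jac x i j)}.
      apply: continuousB; last exact: cst_continuous.
      by apply: continuous_coord; exact: smooth_derive_cont.
    exact: continuousM.
  have : frob2 (Jac x - Jac x) < e.
    by rewrite subrr /frob2 big1// => j _; rewrite big1// => i _; rewrite mxE expr0n.
  by move=> h; apply: (cvgr_lt _ c).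
have /near_cball[d d0 dP] : \forall y \near x, U y /\ frob2 (Jac y - Jac x) < e.
  by near=> y; split; near: y => //; exact: open_nbhs_nbhs.
have close v y : frob2 (Jac y - Jac x) < e ->
    edot (v *m Jac y - v *m Jac x) (v *m Jac y - v *m Jac x) <= edot v v * e.
  move=> /ltW h; rewrite -mulmxBr; apply: le_trans (edot_mulmx_le _ _) _.
  exact: ler_wpM2l (edot_ge0 _) _ _ h.
exists d => //; split=> [y /dP[]//|y z yd zd yz].
set v := y - z; have v0 : v != 0 by rewrite subr_eq0.
pose p s := z + s *: v.
have pd s : 0 <= s <= 1 -> `|p s - x| <= d.
  move=> /andP[s0 s1].
  have -> : p s - x = s *: (y - x) + (1 - s) *: (z - x).
    by rewrite /p /v; apply/rowP => i; rewrite !mxE; ring.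
  rewrite (le_trans (ler_normD _ _))// !normrZ (ger0_norm s0) ger0_norm ?subr_ge0//.
  by have -> : d = s * d + (1 - s) * d; [ring|rewrite lerD// ler_wpM2l// subr_ge0].
pose w := 'D_v Y y.
have dg s : 0 <= s <= 1 ->
    is_derive (s : R) 1 (fun s => edot w (Y (p s))) (edot w ('D_v Y (p s))).
  move=> s01; have [Up _] := dP _ (pd _ s01).
  have h : is_derive s 1 (fun s => Y (p s)) ('D_v Y (p s)).
    by apply: is_derive_line; apply/derivableP/diff_derivable/smooth_diff.
  apply: is_derive_sumf => j.
  have hj := (is_derive_rowP _ _ _ _).1 h j.
  by apply: is_derive_eq; rewrite /GRing.scale/=; ring.
have [||s] := @MVT _ (fun s => edot w (Y (p s))) (fun s => edot w ('D_v Y (p s))) 0 1 ltr01.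
- by move=> s; rewrite in_itv/= => /andP[s0 s1]; apply: dg; rewrite !ltW.
- by apply: derivable_within_continuous => s; rewrite in_itv/= => /dg.
rewrite in_itv/= subr0 mulr1 /p scale1r scale0r addr0 => /andP[s0 s1].
rewrite {1}/v (addrC z) subrK -edotBr => ->.
have [Uy Jy] := dP _ yd.
have /dP[Up Jp] : `|p s - x| <= d by apply: pd; rewrite !ltW.
rewrite /w !deriveJac// -/(p s).
apply: (@edot_perturb_gt0 _ _ _ (v *m Jac x) (edot v v * e)).
- exact: close.
- exact: close.
have -> : 6 * (edot v v * e) = edot v v / t / 2.
  by rewrite /e; field; rewrite gt_eqF.
have := vJ v; rewrite -ler_pdivrMr//.
have : 0 < edot v v / t by rewrite divr_gt0// edot_gt0.
move: (edot v v / t) (edot _ _) => q r q0 qr.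
by rewrite (lt_le_trans _ qr)// ltr_pdivrMr// ltr_pMr// ltr1n.
Unshelve. all: by end_near. Qed.

End Transversality.

Lemma continuous_diag_quad (R : realType) m (al be : 'rV[R]_m) :
  continuous (diag_quad al be).
Proof.
move=> X; apply: continuous_sumf => j.
have c : {for X, continuous (fun X : 'rV[R]_m => X 0 j)} by exact: coord_continuous.
apply: continuousD; apply: continuousM => //; try exact: cst_continuous.
by apply: (@continuousM _ _ (fun X : 'rV[R]_m => X 0 j) (fun X : 'rV[R]_m => X 0 j)).
Qed.

Section Barrier.
Variables (R : realType) (n m : nat) (U : set 'rV[R]_n) (Y : 'rV[R]_n -> 'rV[R]_m).
Hypotheses (oU : open U) (sY : smooth_on U Y).

(** Hopf's barrier. With [s X = |X - P|^2 - |Y y0 - P|^2] take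
    [h = - s + al * s^2]. Its drift Laplacian is
    [(2 al s - 1) L s + 2 al |grad s|^2]; near [y0] the function [L s] is bounded,
    and the tangential gradient of [s] stays away from 0 because [Y y0 - P] is
    not normal, so a large [al] makes it positive. *)
Lemma ex_barrier (y0 : 'rV[R]_n) (P : 'rV[R]_m) (w : 'rV[R]_n) : U y0 ->
  0 < edot ('D_w Y y0) (Y y0 - P) ->
  exists (h : 'rV[R]_m -> R) (G : 'rV[R]_m -> 'rV[R]_m) (Q : 'rV[R]_m -> 'rV[R]_m -> R),
    [/\ continuous h, h (Y y0) = 0, forall X, jet2_at h X (G X) (Q X) &
    \forall y \near y0,
      (edot (Y y0 - P) (Y y0 - P) < edot (Y y - P) (Y y - P) -> h (Y y) < 0) /\
      forall v, orthonormal (fun i => 'D_(v i) Y y) ->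
        2^-1 * edot (G (Y y)) (Y y) < \sum_(i < n) Q (Y y) ('D_(v i) Y y)].
Proof.
move=> Uy0 tau0.
pose s0 := edot (Y y0 - P) (Y y0 - P).
pose k := edot P P - s0.
pose s (X : 'rV[R]_m) := diag_quad (const_mx 1) (-2 *: P) X + k.
have sE X : s X = edot (X - P) (X - P) - s0.
  rewrite /s edotBB /k addrA; congr (_ + _ - _); rewrite /diag_quad big_split/=.
  congr (_ + _); first by apply: eq_bigr => j _; rewrite mxE mul1r expr2.
  by rewrite mulr_sumr -sumrN; apply: eq_bigr => j _; rewrite mxE; ring.
have sG X : jet2_at s X (2 *: (X - P)) (fun E => 2 * edot E E).
  have /= h := jet2_atD (@jet2_at_diag_quad _ _ (const_mx 1) (-2 *: P) X) (@jet2_at_cst _ _ k X).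
  apply: jet2_at_eq h _ _.
    by rewrite addr0; apply/rowP => j; rewrite !mxE; ring.
  move=> E; rewrite addr0 mulr_sumr; apply: eq_bigr => j _.
  by rewrite mxE; ring.
have cs : continuous s.
  move=> X; apply: continuousD; [exact: continuous_diag_quad|exact: cst_continuous].
have cY : {for y0, continuous Y} := smooth_cont sY Uy0.
have cYP : {for y0, continuous (fun y => Y y - P)}.
  by apply: continuousB => //; exact: cst_continuous.
have cD : {for y0, continuous (fun y => 'D_w Y y)} by exact: smooth_derive_cont Uy0.
pose tau y := edot ('D_w Y y) (Y y - P).
pose D y := edot ('D_w Y y) ('D_w Y y).
pose l y : R := 2 * n%:R - edot (Y y - P) (Y y).
have ctau : {for y0, continuous tau} by exact: continuous_edot.
have cDD : {for y0, continuous D} by exact: continuous_edot.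
have cl : {for y0, continuous l}.
  by apply: continuousB; [exact: cst_continuous|exact: continuous_edot].
pose L := `|l y0| + 1.
have L0 : 0 < L by rewrite ltr_wpDl.
have D0 : 0 < D y0 + 1 by rewrite ltr_wpDl// edot_ge0.
pose kap := tau y0 ^+ 2 / (D y0 + 1).
have kap0 : 0 < kap by rewrite divr_gt0// exprn_gt0.
pose al := (L + 1) / kap.
have al0 : 0 < al by rewrite divr_gt0// ltr_wpDl// ltW.
exists (fun X => -1 * s X + al * (s X * s X)).
exists (fun X => -1 *: (2 *: (X - P)) +
  al *: (s X *: (2 *: (X - P)) + s X *: (2 *: (X - P)))).
exists (fun X E => -1 * (2 * edot E E) + al * (s X * (2 * edot E E) +
   2 * (edot (2 *: (X - P)) E * edot (2 *: (X - P)) E) + s X * (2 * edot E E))).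
split.
- move=> X.
  apply: (@continuousD _ _ _ (fun X => -1 * s X) (fun X => al * (s X * s X))).
    by apply: (@continuousM _ _ (fun=> -1) s); [exact: cst_continuous|exact: cs].
  apply: (@continuousM _ _ (fun=> al) (fun X => s X * s X)); first exact: cst_continuous.
  by apply: (@continuousM _ _ s s) => //; exact: cs.
- by rewrite sE subrr !mulr0 addr0.
- by move=> X; apply: jet2_atD; apply: jet2_atZ => //; exact: jet2_atM.
have ntau : \forall y \near y0, tau y0 / 2 < tau y.
  by apply: (cvgr_gt _ ctau); rewrite ltr_pdivrMr// ltr_pMr// ltr1n.
have nD : \forall y \near y0, D y < D y0 + 1 by apply: (cvgr_lt _ cDD); rewrite ltrDl.
have nl : \forall y \near y0, `|l y| < L.
  have cn : {for y0, continuous (fun y => `|l y|)}.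
    by apply: (@continuous_comp _ _ _ l (fun z => `|z|)) => //; exact: norm_continuous.
  by apply: (cvgr_lt _ cn); rewrite ltrDl.
have ns : \forall y \near y0, `|al * s (Y y)| < 2^-1.
  have c1 : {for y0, continuous (fun y => s (Y y))}.
    by apply: (@continuous_comp _ _ _ Y s) => //; exact: cs.
  have c2 : {for y0, continuous (fun y => al * s (Y y))}.
    by apply: continuousM => //; exact: cst_continuous.
  have cn : {for y0, continuous (fun y => `|al * s (Y y)|)}.
    apply: (@continuous_comp _ _ _ (fun y => al * s (Y y)) (fun z => `|z|)) => //.
    exact: norm_continuous.
  by apply: (cvgr_lt _ cn); rewrite sE subrr mulr0 normr0.
near=> y; have Uy : U y by near: y; exact: open_nbhs_nbhs.
have : `|al * s (Y y)| < 2^-1 by near: y.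
rewrite ltr_norml => /andP[als1 als2]; split.
  rewrite -subr_gt0 -sE => s1; rewrite mulrA -mulrDl pmulr_llt0//.
  by rewrite (lt_trans (_ : _ < -1 + 2^-1)) ?ltrD2l//; lra.
move=> v onv.
have -> : \sum_(i < n) (-1 * (2 * edot ('D_(v i) Y y) ('D_(v i) Y y)) + al *
     (s (Y y) * (2 * edot ('D_(v i) Y y) ('D_(v i) Y y)) +
   2 * (edot (2 *: (Y y - P)) ('D_(v i) Y y) * edot (2 *: (Y y - P)) ('D_(v i) Y y)) +
   s (Y y) * (2 * edot ('D_(v i) Y y) ('D_(v i) Y y)))) =
  (-1 + 2 * (al * s (Y y))) * (2 * n%:R) +
  8 * al * \sum_(i < n) edot (Y y - P) ('D_(v i) Y y) ^+ 2.
  transitivity (\sum_(i < n) ((-1 + 2 * (al * s (Y y))) * 2 +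
      8 * al * edot (Y y - P) ('D_(v i) Y y) ^+ 2)).
    by apply: eq_bigr => i _; rewrite onv eqxx /= !edotZl; ring.
  by rewrite big_split/= sumr_const card_ord -mulr_sumr -[_ *+ n]mulr_natr; ring.
rewrite edotDl !edotZl (edotDl (s _ *: _)) !edotZl.
(* A lower bound for the tangential part of [Y y - P], from the single tangent
   vector ['D_w Y y]. *)
have Sn : tau y ^+ 2 <= D y * \sum_(i < n) edot (Y y - P) ('D_(v i) Y y) ^+ 2.
  have [c wE] := frame_span w (smooth_diff sY Uy) onv.
  by rewrite /tau edotC /D wE; exact: edot_span_le.
set S := \sum_(i < n) _ in Sn *.
have S0 : 0 <= S by apply: sumr_ge0 => i _; exact: sqr_ge0.
have : kap <= 4 * S.
  rewrite /kap ler_pdivrMr//.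
  have : D y * S <= (D y0 + 1) * S by rewrite ler_wpM2r// ltW//; near: y.
  have : (tau y0 / 2) ^+ 2 <= tau y ^+ 2.
    have ty : tau y0 / 2 < tau y by near: y.
    have t2 : 0 < tau y0 / 2 by rewrite divr_gt0.
    have t3 := lt_trans t2 ty.
    by rewrite ler_sqr ?nnegrE; exact: ltW.
  have -> : 4 * S * (D y0 + 1) = 4 * ((D y0 + 1) * S) by ring.
  rewrite exprMn; move: Sn.
  move: (D y * S) (tau y ^+ 2) (tau y0 ^+ 2) ((D y0 + 1) * S) => *; lra.
rewrite -(ler_pM2l al0) {1}/al divfK ?gt_eqF// => aS.
have : `|l y| < L by near: y.
rewrite ltr_norml /l => /andP[l1 l2].
move: als1 als2 l1 l2 aS.
set e := edot _ _; set a := al * s _; set N := n%:R => a1 a2 l1 l2 aS.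
rewrite -subr_gt0.
have -> : (-1 + 2 * a) * (2 * N) + 8 * al * S - 2^-1 * (-1 * (2 * e) +
  al * (s (Y y) * (2 * e) + s (Y y) * (2 * e))) =
  (-1 + 2 * a) * (2 * N - e) + 2 * (al * (4 * S)) by rewrite /a; field.
have : - (2 * L) < (-1 + 2 * a) * (2 * N - e) by nra.
lra.
Unshelve. all: by end_near. Qed.

End Barrier.

Section StrongMax.
Variables (R : realType) (n m : nat) (U : set 'rV[R]_n) (Y : 'rV[R]_n -> 'rV[R]_m).
Hypotheses (oU : open U) (sY : smooth_on U Y).
Hypothesis injY : forall x, U x -> injective ('d Y x).
Hypothesis frY : forall x, U x -> exists v, shrinker_frame Y x v.
Variables (f : 'rV[R]_m -> R) (G : 'rV[R]_m -> 'rV[R]_m) (Q : 'rV[R]_m -> 'rV[R]_m -> R).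
Hypotheses (cf : continuous f) (fG : forall X, jet2_at f X (G X) (Q X)).
Hypothesis subh : forall x (E : 'I_n -> 'rV[R]_m), U x -> orthonormal E ->
  2^-1 * edot (G (Y x)) (Y x) <= \sum_i Q (Y x) (E i).

(** Hopf's strong maximum principle, with balls of the ambient space. Otherwise
    some [x1] near [x0] satisfies [f (Y x1) < mu]; let [y0] minimize the distance
    from [Y x1] among the points where [f \o Y] is [mu]. The ball whose diameter
    joins [Y x1] to [Y y0] contains no other such point, and near [y0] its barrier
    [h] is negative outside it. For small [e], [f + e h] is then below [mu] on a
    small sphere about [y0] and equals [mu] at [y0]: it has an interior maximum, where its drift
    Laplacian is positive. *)
Lemma strong_max x0 : U x0 -> (\forall x \near x0, f (Y x) <= f (Y x0)) ->
  \forall x \near x0, f (Y x) = f (Y x0).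
Proof.
move=> Ux0 x0max; set mu := f (Y x0) in x0max *.
have cfY y : U y -> {for y, continuous (fun y => f (Y y))}.
  move=> Uy; apply: (@continuous_comp _ _ _ Y f); first exact: smooth_cont Uy.
  exact: cf.
have cdist P y : U y -> {for y, continuous (fun y => edot (Y y - P) (Y y - P))}.
  move=> Uy; have c : {for y, continuous (fun y => Y y - P)}.
    by apply: continuousB; [exact: smooth_cont Uy|exact: cst_continuous].
  exact: continuous_edot.
have [d1 d10 [d1U d1T]] := ex_transversal_ball oU sY Ux0 (@injY _ Ux0).
have [d2 d20 d2max] := near_cball x0max.
pose d := Num.min d1 d2.
have d0 : 0 < d by rewrite lt_min d10.
have dU y : `|y - x0| <= d -> U y.
  by move=> yd; apply: d1U; rewrite (le_trans yd)// ge_min lexx.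
have dT y z : `|y - x0| <= d -> `|z - x0| <= d -> y != z ->
    0 < edot ('D_(y - z) Y y) (Y y - Y z).
  by move=> yd zd; apply: d1T; [rewrite (le_trans yd)|rewrite (le_trans zd)];
    rewrite // ge_min lexx.
have dmax y : `|y - x0| <= d -> f (Y y) <= mu.
  by move=> yd; apply: d2max; rewrite (le_trans yd)// ge_min lexx orbT.
have dinj y z : `|y - x0| <= d -> `|z - x0| <= d -> y != z ->
    0 < edot (Y y - Y z) (Y y - Y z).
  move=> yd zd yz; rewrite edot_gt0; apply: contraTneq (dT _ _ yd zd yz) => ->.
  by rewrite edotC edotE mul0mx mxE ltxx.
have [a a0 amin] : exists2 a, 0 < a &
    forall y, `|y - x0| = d -> a <= edot (Y y - Y x0) (Y y - Y x0).
  apply: (compact_pos_lb (@compact_csphere _ _ x0 d)) => y /= yd.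
    by apply: cdist; apply: dU; rewrite yd.
  apply: dinj; rewrite ?yd ?subrr ?normr0 ?lexx ?(ltW d0)//.
  by apply: contraTneq d0 => yx; rewrite -yd yx subrr normr0 ltxx.
have near_a : \forall x \near x0, edot (Y x - Y x0) (Y x - Y x0) < a / 4.
  have := @cvgr_lt _ _ _ _ _ _ (cdist (Y x0) _ Ux0) (a / 4); apply.
  by rewrite subrr edotE mul0mx mxE divr_gt0.
near=> x1; apply: contrapT => /eqP fx1.
have x1d : `|x1 - x0| < d by near: x1; exact: near_ball.
have x1a : edot (Y x1 - Y x0) (Y x1 - Y x0) < a / 4 by near: x1.
have {}fx1 : f (Y x1) < mu by rewrite lt_neqAle fx1 dmax// ltW.
pose Z := [set y | `|y - x0| <= d] `&` [set y | f (Y y) = mu].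
have cZ : compact Z.
  apply: (@subclosed_compact _ _ [set y | `|y - x0| <= d]).
  - by apply: closed_level => [|y /dU]; [exact: closed_cball|exact: cfY].
  - exact: compact_cball.
  - exact: subIsetl.
have Zx0 : Z x0 by split=> //=; rewrite subrr normr0 ltW.
have [y0 [/= y0d fy0] y0min] : exists2 c, Z c & forall y, Z y ->
    edot (Y c - Y x1) (Y c - Y x1) <= edot (Y y - Y x1) (Y y - Y x1).
  by apply: (compact_min cZ); [exists x0|move=> y [/= /dU Uy _]; exact: cdist].
have Uy0 := dU _ y0d.
have y0x1 : y0 != x1 by apply: contraTneq fx1 => <-; rewrite fy0 ltxx.
(* [Y x1] is so close to [Y x0] that points at distance [d] from [x0] cannot
   compete with [x0] for the minimum. *)
have {}y0d : `|y0 - x0| < d.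
  rewrite lt_neqAle y0d andbT; apply/eqP => /amin ay0.
  have := y0min _ Zx0; have := edot_ge0 (Y y0 - Y x1 + (Y x0 - Y x1)).
  move: ay0 x1a.
  have -> : Y y0 - Y x0 = (Y y0 - Y x1) - (Y x0 - Y x1).
    by rewrite opprB addrA subrK.
  have -> : Y x1 - Y x0 = - 1 *: (Y x0 - Y x1) by rewrite scaleN1r opprB.
  move: (Y y0 - Y x1) (Y x0 - Y x1) => p q.
  by rewrite edotBB edotDl !edotDr !(edotZl, edotZr) (edotC q p); lra.
pose P := 2^-1 *: (Y x1 + Y y0).
have tau0 : 0 < edot ('D_(y0 - x1) Y y0) (Y y0 - P).
  have -> : Y y0 - P = 2^-1 *: (Y y0 - Y x1).
    by apply/rowP => j; rewrite !mxE; field.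
  by rewrite edotZr pmulr_rgt0// dT// ltW.
have [h [Gh [Qh [ch h0 hG nh]]]] := ex_barrier oU sY Uy0 tau0.
have : \forall y \near y0, `|y - x0| < d /\
    ((edot (Y y0 - P) (Y y0 - P) < edot (Y y - P) (Y y - P) -> h (Y y) < 0) /\
      forall v, orthonormal (fun i => 'D_(v i) Y y) ->
        2^-1 * edot (Gh (Y y)) (Y y) < \sum_(i < n) Qh (Y y) ('D_(v i) Y y)).
  near=> y; split; last by near: y.
  near: y; have : \forall y \near y0, `|y - y0| < d - `|y0 - x0|.
    by apply: near_ball; rewrite subr_gt0.
  apply: filterS => y; rewrite ltrBrDr => /le_lt_trans; apply.
  by rewrite -(subrKA y0) ler_normD.
move=> /near_cball[s s0 sP].
have sd y : `|y - y0| <= s -> `|y - x0| <= d by move=> /sP[/ltW].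
have sU y : `|y - y0| <= s -> U y by move=> /sd /dU.
have chY y : U y -> {for y, continuous (fun y => h (Y y))}.
  move=> Uy; apply: (@continuous_comp _ _ _ Y h); first exact: smooth_cont Uy.
  exact: ch.
have [e e0 eP] : exists2 e, 0 < e &
    forall y, `|y - y0| = s -> e * h (Y y) < mu - f (Y y).
  apply: (compact_perturb (@compact_csphere _ _ y0 s)) => y /= ys.
  - have Uy : U y by apply: sU; rewrite ys.
    by apply: continuousB; [exact: cst_continuous|exact: cfY].
  - by apply: chY; apply: sU; rewrite ys.
  - by rewrite subr_ge0 dmax// sd// ys.
  move=> /eqP; rewrite subr_eq0 => /eqP fy.
  have ysle : `|y - y0| <= s by rewrite ys.
  have [_ [hneg _]] := sP _ ysle; apply: hneg.
  rewrite -subr_gt0 -(pmulr_rgt0 _ (ltr0n R 2)) edot_midpoint.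
  rewrite ltr_wpDl ?subr_ge0 ?y0min//; first by split=> //=; exact: sd.
  apply: dinj; [exact: sd|exact: ltW|].
  by apply: contraTneq s0 => yx; rewrite -ys yx subrr normr0 ltxx.
pose F y := f (Y y) + e * h (Y y).
have [y1 /= y1s y1max] : exists2 c, `|c - y0| <= s & forall y, `|y - y0| <= s -> F y <= F c.
  apply: (compact_max (@compact_cball _ _ y0 s)).
    by exists y0; rewrite /= subrr normr0 ltW.
  move=> y /= /sU Uy; apply: continuousD; first exact: cfY.
  by apply: continuousM; [exact: cst_continuous|exact: chY].
have Fy0 : F y0 = mu by rewrite /F h0 mulr0 addr0 fy0.
have {}y1s : `|y1 - y0| < s.
  rewrite lt_neqAle y1s andbT; apply/eqP => /eP.
  rewrite ltrBrDl -/(F y1) ltNge -Fy0 y1max// subrr normr0 ltW//.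
have Uy1 : U y1 by apply: sU; exact: ltW.
have [v fv] := frY Uy1.
have FG := jet2_atD (@fG (Y y1)) (jet2_atZ e (hG (Y y1))).
have [|_] := frame_max sY oU Uy1 fv FG.
  near=> y; apply: y1max; rewrite ltW//; near: y.
  have : \forall y \near y1, `|y - y1| < s - `|y1 - y0|.
    by apply: near_ball; rewrite subr_gt0.
  apply: filterS => y; rewrite ltrBrDr => /le_lt_trans; apply.
  by rewrite -(subrKA y1) ler_normD.
have [onv _] := fv.
have [_ [_ hsub]] := sP _ (ltW y1s).
apply/negP; rewrite -ltNge big_split/= edotDl mulrDr ler_ltD//; first exact: subh.
by rewrite -mulr_sumr edotZl mulrCA ltr_pM2l// hsub.
Unshelve. all: by end_near. Qed.

End StrongMax.

(** * Self-shrinkers as immersed manifolds *)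

Lemma compact_edot_ball (R : realType) (m : nat) (T : R) :
  compact [set v : 'rV[R]_m | edot v v <= T].
Proof.
have coordb (v : 'rV[R]_m) : edot v v <= T -> `|v| <= `|T| + 1.
  move=> vT; rewrite [leLHS]/Num.Def.normr/= mx_normrE bigmax_le// ?addr_ge0// => -[i j] _ /=.
  rewrite ord1; have := le_trans (le_trans (edot_sqr_le v j) vT) (ler_norm T).
  rewrite -real_normK ?num_real//; have := normr_ge0 (v 0 j).
  by move: `|v 0 j| (`|T|) => a b a0 ab; nra.
apply: (@subclosed_compact _ _ [set v : 'rV[R]_m | `|v - 0| <= `|T| + 1]).
- have -> : [set v : 'rV[R]_m | edot v v <= T] =
      (fun v : 'rV[R]_m => edot v v) @^-1` [set t | t <= T] by [].
  apply: preimage_closed; last exact: closed_le.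
  by move=> v _; apply: continuous_edot; exact: cvg_id.
- exact: compact_cball.
- by move=> v /= vT; rewrite subr0; exact: coordb.
Qed.

Section Manifold.
Variables (R : realType) (n m : nat) (M : smooth_manifold R n) (X : M -> 'rV[R]_m).
Hypothesis X_proper : properly_immersed X.
Hypothesis X_shrinker : self_shrinker X.
Implicit Types (q : M) (f : 'rV[R]_m -> R).

Let X_imm : immersion X := X_proper.1.

Section Chart.
Variables (c : chart R n M) (q : M).
Hypotheses (ac : atlas M c) (cq : chart_dom c q).
Let x := chart_map c q.
Let Y := X \o chart_inv c.

Lemma chart_cod_mem : chart_cod c x.
Proof. by exists q. Qed.

Lemma chart_mapKX : Y x = X q.
Proof. by rewrite /Y /= chart_mapK. Qed.

Lemma near_chart_inv (P : set M) : (\forall q' \near q, P q') ->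
  \forall y \near x, P (chart_inv c y).
Proof.
have := chart_inv_continuous chart_cod_mem.
by rewrite /prop_for /continuous_at /x chart_mapK//; exact.
Qed.

Lemma near_chart_map (P : set M) : (\forall y \near x, P (chart_inv c y)) ->
  \forall q' \near q, P q'.
Proof.
move=> nP.
have n1 : \forall q' \near q, P (chart_inv c (chart_map c q')).
  by have /(_ _ nP) := chart_map_continuous cq.
have n2 : \forall q' \near q, chart_dom c q'.
  by apply: open_nbhs_nbhs; split=> //; exact: chart_dom_open.
by near=> q'; rewrite -(chart_mapK (near n2 q' _))//; near: q'.
Unshelve. all: by end_near. Qed.

Lemma chart_frame y : chart_cod c y -> exists v, shrinker_frame Y y v.
Proof.
by move=> cy; have := X_shrinker ac cy; apply: ex_shrinker_frame => //; exact: (X_imm ac).1.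
Qed.

End Chart.

Lemma continuous_immersion : continuous X.
Proof.
move=> q; have [c ac cq] := atlas_cover q.
move=> V nV; apply: (near_chart_map cq).
have [sY _] := X_imm ac.
by have := smooth_cont sY (chart_cod_mem cq); apply; rewrite chart_mapKX.
Qed.

Definition local_max f q : Prop := \forall q' \near q, f (X q') <= f (X q).

(** One frame serves all functions [f], so that the gradients of several functions
    can be compared as normal vectors at [q]. *)
Lemma ex_tangent_frame q : exists E : 'I_n -> 'rV[R]_m, orthonormal E /\
  forall f G Q, jet2_at f (X q) G Q -> local_max f q ->
    (forall i, edot G (E i) = 0) /\ \sum_i Q (E i) <= 2^-1 * edot G (X q).
Proof.
have [c ac cq] := atlas_cover q.
have cx := chart_cod_mem cq; have [sY _] := X_imm ac.
have [v fv] := chart_frame ac cx.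
exists (fun i => 'D_(v i) (X \o chart_inv c) (chart_map c q)).
split=> [|f G Q fG fmax]; first by case: fv.
have := frame_max sY (@chart_cod_open _ _ _ c) cx fv.
rewrite chart_mapKX// => /(_ f G Q fG); apply.
exact: near_chart_inv cq _ fmax.
Qed.

Variables (f : 'rV[R]_m -> R) (G : 'rV[R]_m -> 'rV[R]_m) (Q : 'rV[R]_m -> 'rV[R]_m -> R).
Hypotheses (cf : continuous f) (fG : forall P, jet2_at f P (G P) (Q P)).
Hypothesis subh : forall q (E : 'I_n -> 'rV[R]_m), orthonormal E ->
  2^-1 * edot (G (X q)) (X q) <= \sum_i Q (X q) (E i).

Lemma continuous_fX : continuous (f \o X).
Proof. by move=> q; apply: continuous_comp; [exact: continuous_immersion|exact: cf]. Qed.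

Lemma local_max_near_cst q : local_max f q -> \forall q' \near q, f (X q') = f (X q).
Proof.
move=> fmax; have [c ac cq] := atlas_cover q.
have [sY injY] := X_imm ac.
apply: (near_chart_map cq).
rewrite -(chart_mapKX cq).
apply: (strong_max (@chart_cod_open _ _ _ c) sY injY (chart_frame ac) cf fG).
- by move=> y E _; exact: subh.
- exact: chart_cod_mem.
- by rewrite chart_mapKX//; exact: near_chart_inv cq _ fmax.
Qed.

End Manifold.

(** * The Liouville property *)

Section Properness.
Variables (R : realType) (n m : nat) (M : smooth_manifold R n) (X : M -> 'rV[R]_m).
Hypothesis X_proper : properly_immersed X.
Hypothesis X_shrinker : self_shrinker X.

Lemma compact_sublevel (C : set M) T : closed C ->
  compact (C `&` [set q | edot (X q) (X q) <= T]).
Proof.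
move=> cC; rewrite setIC; apply: compact_closedI => //.
exact: (X_proper.2 _ (@compact_edot_ball R m T)).
Qed.

Lemma proper_max (C : set M) (g : M -> R) B e : closed C -> C !=set0 ->
  continuous g -> 0 < e -> (forall q, C q -> g q <= B - e * edot (X q) (X q)) ->
  exists2 q, C q & forall q', C q' -> g q' <= g q.
Proof.
move=> cC [q0 Cq0] cg e0 gB.
pose T := (B - g q0) / e.
have low q : C q -> g q0 <= g q -> edot (X q) (X q) <= T.
  move=> /gB gq /le_trans -/(_ _ gq); rewrite /T ler_pdivlMr// mulrC; lra.
have [|q [Cq _] qmax] := compact_max (@compact_sublevel C T cC) _ (fun q _ => cg q).
- by exists q0; split=> //=; exact: low.
exists q => // q' Cq'.
have [q0q'|/ltW q'q0] := leP (g q0) (g q'); first by apply: qmax; split=> //=; exact: low.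
by apply: le_trans q'q0 _; apply: qmax; split=> //=; exact: low.
Qed.

Variables (f : 'rV[R]_m -> R) (G : 'rV[R]_m -> 'rV[R]_m) (Q : 'rV[R]_m -> 'rV[R]_m -> R).
Hypotheses (cf : continuous f) (fG : forall P, jet2_at f P (G P) (Q P)).
Hypothesis subh : forall q (E : 'I_n -> 'rV[R]_m), orthonormal E ->
  2^-1 * edot (G (X q)) (X q) <= \sum_i Q (X q) (E i).
Variable B : R.
Hypothesis fB : forall q, f (X q) <= B.

Let sq : 'rV[R]_m -> R := diag_quad (const_mx 1) 0.

Let sqE P : sq P = edot P P.
Proof. by apply: eq_bigr => j _; rewrite !mxE mul0r addr0 mul1r expr2. Qed.

(** Since [X] is proper, [f - e |X|^2] attains its maximum on [C]. The drift
    Laplacian of [|X|^2] is [2 n - |X|^2], so the second derivative test places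
    that point in the compact set [|X|^2 <= 2 n], for every [e > 0]. Hence the
    maximum of [f] over this compact set bounds [f] on [C], as [e] tends to 0. *)
Lemma subharmonic_max (C : set M) : open C -> closed C -> C !=set0 ->
  exists2 q, C q & forall q', C q' -> f (X q') <= f (X q).
Proof.
move=> oC cC C0.
have pen e : 0 < e -> exists q, [/\ C q, edot (X q) (X q) <= 2 * n%:R &
    forall q', C q' -> f (X q') - e * edot (X q') (X q') <= f (X q) - e * edot (X q) (X q)].
  move=> e0; pose g P := f P + (- e) * sq P.
  have gE P : g P = f P - e * edot P P by rewrite /g sqE mulNr.
  have cg : continuous (g \o X).
    move=> q; apply: (@continuous_comp _ _ _ X g).
      exact: continuous_immersion X_proper _.
    apply: (@continuousD _ _ _ f (fun P => - e * sq P)); first exact: cf.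
    apply: (@continuousM _ _ (fun=> - e) sq); first exact: cst_continuous.
    exact: continuous_diag_quad.
  have [|q Cq qmax] := @proper_max C (g \o X) B e cC C0 cg e0.
    by move=> q _; rewrite /= gE lerB.
  have lmax : local_max X g q.
    have : \forall q' \near q, C q' by exact: open_nbhs_nbhs.
    by apply: filterS => q'; exact: qmax.
  exists q; split=> // [|q' /qmax]; last by rewrite /= !gE.
  have [E [onE /(_ g _ _ _ lmax)]] := ex_tangent_frame X_proper X_shrinker q.
  move=> /(_ _ _ (jet2_atD (@fG (X q)) (jet2_atZ (- e)
    (@jet2_at_diag_quad _ _ (const_mx 1) 0 (X q))))).
  case=> _; rewrite big_split/= edotDl edotZl mulrDr.
  have -> : \sum_(i < n) - e * (\sum_j 2 * (const_mx 1 : 'rV_m) 0 j * E i 0 j ^+ 2) =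
      - e * (2 * n%:R).
    rewrite -(sum_coord_sqr onE) exchange_big/= -mulr_sumr; congr (_ * _).
    rewrite mulr_sumr; apply: eq_bigr => i _; rewrite mulr_sumr.
    by apply: eq_bigr => j _; rewrite mxE mulr1.
  have -> : edot (\row_j (2 * (const_mx 1 : 'rV_m) 0 j * X q 0 j + (0 : 'rV_m) 0 j)) (X q) =
      2 * edot (X q) (X q).
    by rewrite -edotZl; congr edot; apply/rowP => j; rewrite !mxE mulr1 addr0.
  have := subh q onE; set a := edot (G _) _; set b := \sum_(i < n) _ => ab bound.
  rewrite -(ler_pM2l e0).
  by move: bound; move: (edot _ _) (n%:R) => u v; lra.
pose K := C `&` [set q | edot (X q) (X q) <= 2 * n%:R].
have [q1 [Cq1 q1n _]] := pen 1 ltr01.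
have [||q [Cq _] qmax] := @compact_max _ _ K (@compact_sublevel C _ cC) (f \o X).
- by exists q1; split.
- by move=> q _; exact: (continuous_fX X_proper cf).
(* An excess [a] at [q'] contradicts the bound for the weight [e] with
   [e |X q'|^2 < a]. *)
exists q => // q' Cq'; rewrite leNgt; apply/negP => lt_q.
pose a := f (X q') - f (X q).
have a0 : 0 < a by rewrite subr_gt0.
have N0 : 0 < edot (X q') (X q') + 1 by rewrite ltr_wpDl ?edot_ge0.
have e0 : 0 < a / (edot (X q') (X q') + 1) by rewrite divr_gt0.
have [q2 [Cq2 q2n /(_ _ Cq')]] := pen _ e0.
apply/negP; rewrite -ltNge.
apply: (@le_lt_trans _ _ (f (X q))).
  by rewrite (le_trans _ (qmax _ (conj Cq2 q2n)))//= gerBl mulr_ge0 ?edot_ge0// ltW.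
rewrite ltrBrDr -ltrBrDl -/a mulrAC ltr_pdivrMr// ltr_pM2l// ltrDl//.
Qed.

(** Small segments in a chart are connected. *)
Lemma open_component q : open (connected_component [set: M] q).
Proof.
rewrite openE => q' Cq'; rewrite /interior.
have [c ac cq] := atlas_cover q'.
apply: (near_chart_map cq).
have cx := chart_cod_mem cq.
have /nbhs_ballP[e /= e0 eB] : nbhs (chart_map c q') (chart_cod c).
  by apply: open_nbhs_nbhs; split=> //; exact: chart_cod_open.
near=> y.
have ye : ball (chart_map c q') e y by near: y; exact: nbhsx_ballx.
rewrite (same_connected_component Cq').
pose p (t : R) := chart_map c q' + t *: (y - chart_map c q').
have p0 : chart_inv c (p 0) = q' by rewrite /p scale0r addr0 chart_mapK.
have p1 : chart_inv c (p 1) = chart_inv c y by rewrite /p scale1r addrC subrK.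
apply: (@connected_component_max _ _ ((chart_inv c \o p) @` `[0, 1])) => //.
- by exists 0 => //=; rewrite in_itv/= lexx ler01.
- apply: connected_continuous_connected; first exact: segment_connected.
  apply: continuous_in_subspaceT => t; rewrite inE/= in_itv/= => /andP[t0 t1].
  apply: continuous_comp.
    apply: continuousD; first exact: cst_continuous.
    exact: scalel_continuous.
  apply: chart_inv_continuous; apply: eB; rewrite -ball_normE/= /p opprD addrA subrr.
  rewrite sub0r normrN normrZ ger0_norm//.
  move: ye; rewrite -ball_normE/= distrC; apply: le_lt_trans.
  by rewrite ler_piMl.
- by exists 1 => //=; rewrite in_itv/= ler01 lexx.
Unshelve. all: by end_near. Qed.

(** Liouville property of proper self-shrinkers. The points of the connected
    component of [q] where [f \o X] attains its maximum over that component form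
    an open set by the strong maximum principle, and a closed one. *)
Theorem subharmonic_near_cst q : \forall q' \near q, f (X q') = f (X q).
Proof.
pose C := connected_component [set: M] q.
have Cq : C q by exact: connected_component_refl.
have oC : open C by exact: open_component.
have cC : closed C by apply: component_closed; exact: closedT.
have [q0 Cq0 q0max] := subharmonic_max oC cC (ex_intro _ q Cq).
pose Z := C `&` [set q' | f (X q') = f (X q0)].
have cZ : closed Z by apply: closed_level => // q' _; exact: (continuous_fX X_proper cf).
have oZ : open Z.
  rewrite openE => q' [Cq' /= fq']; rewrite /interior.
  have nC : \forall z \near q', C z by exact: open_nbhs_nbhs.
  have : \forall z \near q', f (X z) = f (X q').
    apply: (local_max_near_cst X_proper X_shrinker cf fG subh).
    by apply: filterS nC => z Cz; rewrite fq'; exact: q0max.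
  by move=> nz; near=> z; split; [near: z|rewrite /= -fq'; near: z].
have ZC : Z = C.
  apply: (@component_connected _ [set: M] q Z); first by exists q0.
  - by exists Z => //; rewrite setIidr//; exact: subIsetl.
  - by exists Z => //; rewrite setIidr//; exact: subIsetl.
have : \forall z \near q, Z z by rewrite ZC; exact: open_nbhs_nbhs.
have : Z q by rewrite ZC.
by move=> [_ /= ->]; apply: filterS => z [].
Unshelve. all: by end_near. Qed.

End Properness.

(** * Quadratic functions adapted to a cylinder *)

Section EuclideanBall.
Variables (R : realType) (d : nat) (a : 'rV[R]_d) (t : R).

Lemma closure_eball_le (y : 'rV[R]_d) :
  closure (eball a (Num.sqrt t)) y -> edot (y - a) (y - a) <= t.
Proof.
pose F (z : 'rV[R]_d) : 'rV[R]_d := z - a.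
have cF : continuous F.
  by move=> z; apply: continuousB; [exact: cvg_id|exact: cst_continuous].
have clo : closed [set z : 'rV[R]_d | edot (z - a) (z - a) <= t].
  have -> : [set z : 'rV[R]_d | edot (z - a) (z - a) <= t] =
      (fun z : 'rV[R]_d => edot (F z) (F z)) @^-1` [set s | s <= t] by [].
  apply: preimage_closed; last exact: closed_le.
  by move=> z _; apply: continuous_edot; exact: cF.
move=> ya; apply: clo; apply: closureS ya => z; rewrite /eball/= /enorm.
have [t0|t0] := leP 0 t.
  have [z0|z0] := ltP 0 (edot (z - a) (z - a)).
    have [t1|t1] := ltP 0 t; first by rewrite ltr_sqrt// => /ltW.
    by rewrite (ler0_sqrtr t1) ltNge sqrtr_ge0.
  by move=> _; rewrite (le_trans z0).
by rewrite (ler0_sqrtr (ltW t0)) ltNge sqrtr_ge0.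
Qed.

Lemma closure_eball_ge (y : 'rV[R]_d) : 0 < t -> edot (y - a) (y - a) <= t ->
  closure (eball a (Num.sqrt t)) y.
Proof.
move=> t0 yt V /(near_line (a - y))/nbhs_ballP[e /= e0 eV].
pose s := Num.min (e / 2) 2^-1.
have s0 : 0 < s by rewrite lt_min divr_gt0//= invr_gt0.
have s1 : s <= 2^-1 by rewrite ge_min lexx orbT.
have se : s < e.
  by rewrite gt_min ltr_pdivrMr// ltr_pMr// ltr1n.
exists (y + s *: (a - y)); split; last first.
  by apply: eV; rewrite -ball_normE/= sub0r normrN gtr0_norm.
rewrite /eball/= /enorm ltr_sqrt//.
have -> : y + s *: (a - y) - a = (1 - s) *: (y - a).
  by apply/rowP => j; rewrite !mxE; ring.
rewrite edotZl edotZr mulrA.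
apply: (@le_lt_trans _ _ ((1 - s) * (1 - s) * t)).
  by rewrite ler_wpM2l// -expr2 sqr_ge0.
by rewrite gtr_pMl//; nra.
Qed.

End EuclideanBall.

Section Split.
Variables (R : realType) (d p : nat).
Implicit Types (P E : 'rV[R]_(d + p)).

Lemma edot_split P E :
  edot P E = edot (lsubmx P) (lsubmx E) + edot (rsubmx P) (rsubmx E).
Proof.
by rewrite {1}/edot big_split_ord; congr (_ + _); apply: eq_bigr => j _; rewrite !mxE.
Qed.

(** All functions used below are of this form: separate multiples of the squared
    lengths of the two blocks of coordinates, and a linear term. *)
Definition cyl_quad (c e : R) (b : 'rV[R]_d) (g : 'rV[R]_p) : 'rV[R]_(d + p) -> R :=
  diag_quad (row_mx (const_mx c) (const_mx e)) (row_mx b g).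

Lemma cyl_quadE c e b g P (x := lsubmx P) (y := rsubmx P) :
  cyl_quad c e b g P = c * edot x x + edot b x + (e * edot y y + edot g y).
Proof.
rewrite /cyl_quad /diag_quad big_split_ord; congr (_ + _); rewrite big_split/= mulr_sumr.
  by congr (_ + _); apply: eq_bigr => j _; rewrite row_mxEl ?mxE// expr2.
by congr (_ + _); apply: eq_bigr => j _; rewrite row_mxEr ?mxE// expr2.
Qed.

Lemma jet2_at_cyl_quad c e b g P :
  jet2_at (cyl_quad c e b g) P
    (row_mx ((2 * c) *: lsubmx P + b) ((2 * e) *: rsubmx P + g))
    (fun E => 2 * c * edot (lsubmx E) (lsubmx E) + 2 * e * edot (rsubmx E) (rsubmx E)).
Proof.
apply: jet2_at_eq (@jet2_at_diag_quad _ _ _ _ P) _ _.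
  apply/rowP => j; rewrite -(splitK j); case: (fintype.split j) => i /=.
    by rewrite row_mxEl mxE row_mxEl row_mxEl !mxE.
  by rewrite row_mxEr mxE row_mxEr row_mxEr !mxE.
move=> E; rewrite big_split_ord; congr (_ + _); rewrite mulr_sumr.
  by apply: eq_bigr => j _; rewrite row_mxEl !mxE expr2.
by apply: eq_bigr => j _; rewrite row_mxEr !mxE expr2.
Qed.

Lemma continuous_cyl_quad c e b g : continuous (cyl_quad c e b g).
Proof. exact: continuous_diag_quad. Qed.

(** For an orthonormal tangent frame [E], the sum of the squared lengths of the
    tangential gradients of the first [d] coordinate functions; [rgrad] is the
    same for the other coordinates. *)
Definition lgrad (n : nat) (E : 'I_n -> 'rV[R]_(d + p)) :=
  \sum_i edot (lsubmx (E i)) (lsubmx (E i)).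

Definition rgrad (n : nat) (E : 'I_n -> 'rV[R]_(d + p)) :=
  \sum_i edot (rsubmx (E i)) (rsubmx (E i)).

Variables (n : nat) (E : 'I_n -> 'rV[R]_(d + p)).
Hypothesis onE : orthonormal E.

Lemma lgrad_le : lgrad E <= d%:R.
Proof.
rewrite /lgrad exchange_big/= -[d in d%:R]card_ord -sumr_const; apply: ler_sum => j _.
rewrite (le_trans _ (sum_coord_sqr_le1 onE (lshift p j)))// le_eqVlt; apply/orP; left.
by apply/eqP; apply: eq_bigr => i _; rewrite !mxE expr2.
Qed.

Lemma rgrad_le : rgrad E <= p%:R.
Proof.
rewrite /rgrad exchange_big/= -[p in p%:R]card_ord -sumr_const; apply: ler_sum => j _.
rewrite (le_trans _ (sum_coord_sqr_le1 onE (rshift d j)))// le_eqVlt; apply/orP; left.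
by apply/eqP; apply: eq_bigr => i _; rewrite !mxE expr2.
Qed.

Lemma lgradDrgrad : lgrad E + rgrad E = n%:R.
Proof.
rewrite -big_split/= -[n in RHS]card_ord -sumr_const; apply: eq_bigr => i _.
by rewrite -edot_split onE eqxx.
Qed.

End Split.

Section Cylinder.
Variables (R : realType) (n d p : nat) (M : smooth_manifold R n).
Variable (X : M -> 'rV[R]_(d + p)).
Hypotheses (X_proper : properly_immersed X) (X_shrinker : self_shrinker X).

Lemma cyl_quad_max c e b g q : local_max X (cyl_quad c e b g) q ->
  exists2 E : 'I_n -> 'rV[R]_(d + p), orthonormal E &
    2 * c * lgrad E + 2 * e * rgrad E <=
    2^-1 * (edot ((2 * c) *: lsubmx (X q) + b) (lsubmx (X q)) +
            edot ((2 * e) *: rsubmx (X q) + g) (rsubmx (X q))).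
Proof.
move=> qmax; have [E [onE H]] := ex_tangent_frame X_proper X_shrinker q.
exists E => //; have [_] := H _ _ _ (@jet2_at_cyl_quad _ _ _ c e b g (X q)) qmax.
by rewrite edot_split row_mxKl row_mxKr big_split/= -!mulr_sumr.
Qed.

Lemma cyl_quad_near_cst c e b g B : (forall q, cyl_quad c e b g (X q) <= B) ->
  (forall q (E : 'I_n -> 'rV[R]_(d + p)), orthonormal E ->
    2^-1 * (edot ((2 * c) *: lsubmx (X q) + b) (lsubmx (X q)) +
            edot ((2 * e) *: rsubmx (X q) + g) (rsubmx (X q))) <=
    2 * c * lgrad E + 2 * e * rgrad E) ->
  forall q, \forall q' \near q, cyl_quad c e b g (X q') = cyl_quad c e b g (X q).
Proof.
move=> fB sub q.
apply: (subharmonic_near_cst X_proper X_shrinker (@continuous_cyl_quad _ _ _ c e b g)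
  (@jet2_at_cyl_quad _ _ _ c e b g) _ fB).
move=> {}q E onE; rewrite edot_split row_mxKl row_mxKr big_split/= -!mulr_sumr.
exact: sub.
Qed.

End Cylinder.

(** * Self-shrinkers and cylinders *)

Section Parts.
Variables (R : realType) (n d p : nat) (M : smooth_manifold R n).
Variable (X : M -> 'rV[R]_(d + p)).
Hypotheses (X_proper : properly_immersed X) (X_shrinker : self_shrinker X).
Variable a : 'rV[R]_d.

Lemma near_cst_local_max (f : 'rV[R]_(d + p) -> R) q :
  (\forall q' \near q, f (X q') = f (X q)) -> local_max X f q.
Proof. by apply: filterS => q' ->. Qed.

Section Inside.
Hypothesis inside : forall q, edot (lsubmx (X q) - a) (lsubmx (X q) - a) <=
  2 * (n%:R - p%:R) + edot a a.

(** The function is [|x - 2 a|^2] up to a constant. Its drift Laplacian is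
    [2 |grad x|^2 - |x - a|^2 + |a|^2], which is nonnegative inside the cylinder
    because [|grad x|^2 >= n - p]. *)
Lemma inside_near_cst q : \forall q' \near q,
  cyl_quad 1 0 (- 4 *: a) 0 (X q') = cyl_quad 1 0 (- 4 *: a) (0 : 'rV_p) (X q).
Proof.
apply: (cyl_quad_near_cst X_proper X_shrinker
  (B := 4 * (n%:R - p%:R))) => {}q.
  have := inside q; rewrite cyl_quadE edotBB edotZl (edotC (lsubmx _) a) edot0l.
  by have := edot_ge0 (lsubmx (X q)); lra.
move=> E onE; have := inside q; have := lgradDrgrad onE; have := rgrad_le onE.
rewrite edotBB (edotC (lsubmx _) a) !(edotDl, edotZl) edot0l; lra.
Qed.

(** The drift Laplacian of a locally constant function vanishes, which leaves no
    room in the estimate of [inside_near_cst]. *)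
Lemma inside_sphere q : edot (lsubmx (X q) - a) (lsubmx (X q) - a) =
  2 * (n%:R - p%:R) + edot a a.
Proof.
apply/eqP; rewrite eq_le inside/=.
have [E onE +] := cyl_quad_max X_proper X_shrinker
  (near_cst_local_max (inside_near_cst q)).
have := lgradDrgrad onE; have := rgrad_le onE.
rewrite edotBB (edotC (lsubmx _) a) !(edotDl, edotZl) edot0l; lra.
Qed.

End Inside.

(** Now [- |x - 2 a|^2] has positive drift Laplacian, because
    [|grad x|^2 <= d]; but it is bounded above, hence locally constant. *)
Lemma not_outside : [set: M] !=set0 ->
  ~ forall q, 2 * d%:R + edot a a < edot (lsubmx (X q) - a) (lsubmx (X q) - a).
Proof.
move=> [q0 _] outside.
have cst q : \forall q' \near q,
    cyl_quad (-1) 0 (4 *: a) 0 (X q') = cyl_quad (-1) 0 (4 *: a) (0 : 'rV_p) (X q).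
  apply: (cyl_quad_near_cst X_proper X_shrinker (B := 4 * edot a a)) => {}q.
    rewrite cyl_quadE edotZl edot0l.
    have := edot_ge0 (lsubmx (X q) - 2 *: a).
    by rewrite edotBB !(edotZl, edotZr) (edotC (lsubmx _) a); lra.
  move=> E onE; have := outside q; have := lgrad_le onE.
  rewrite edotBB (edotC (lsubmx _) a) !(edotDl, edotZl) edot0l; lra.
have [E onE +] := cyl_quad_max X_proper X_shrinker (near_cst_local_max (cst q0)).
have := outside q0; have := lgrad_le onE.
rewrite edotBB (edotC (lsubmx _) a) !(edotDl, edotZl) edot0l; lra.
Qed.

End Parts.

Section Hypersurface.
Variables (R : realType) (k p : nat) (M : smooth_manifold R (k + p)).
Variable (X : M -> 'rV[R]_(k.+1 + p)).
Hypotheses (X_proper : properly_immersed X) (X_shrinker : self_shrinker X).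
Hypothesis k0 : (0 < k)%N.
Variable a : 'rV[R]_k.+1.
Hypothesis inside : forall q, edot (lsubmx (X q) - a) (lsubmx (X q) - a) <=
  2 * ((k + p)%:R - p%:R) + edot a a.

(** Both [|x - a|^2] and [|x - 2 a|^2] are locally constant, hence so is [a . x].
    Its drift Laplacian is [- (a . x) / 2], so [a . x = 0]. *)
Lemma hypersurface_sphere q : edot (lsubmx (X q)) (lsubmx (X q)) = 2 * k%:R.
Proof.
have sph q' : edot (lsubmx (X q')) (lsubmx (X q')) - 2 * edot a (lsubmx (X q')) = 2 * k%:R.
  have := inside_sphere X_proper X_shrinker inside q'.
  by rewrite edotBB (edotC (lsubmx _) a) natrD; lra.
have lin q' : cyl_quad 1 0 (- 4 *: a) 0 (X q') = 2 * k%:R - 2 * edot a (lsubmx (X q')).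
  by rewrite cyl_quadE edotZl edot0l -(sph q'); ring.
have cst := inside_near_cst X_proper X_shrinker inside q.
have zcst : \forall q' \near q, edot a (lsubmx (X q')) = edot a (lsubmx (X q)).
  by apply: filterS cst => q'; rewrite !lin; lra.
have zmax s : local_max X (cyl_quad 0 0 (s *: a) 0) q.
  apply: near_cst_local_max; apply: filterS zcst => q' h.
  by rewrite !cyl_quadE !mul0r !edotZl h !edot0l.
have h s : 0 <= s * edot a (lsubmx (X q)).
  have [E _ +] := cyl_quad_max X_proper X_shrinker (zmax s).
  by rewrite !(edotDl, edotZl) edot0l; lra.
by have := sph q; have := h 1; have := h (-1); lra.
Qed.

(** Maximize [f = - |x - xP|^2 - c |y - yP|^2] over the hypersurface. At the
    maximum the gradient of [f] is normal. So is [(x, 0)], the gradient of the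
    constant [|x|^2] up to a factor, and the normal space is a line; this forces
    [y = yP] and [x = xP] or [x = - xP]. In the second case the drift
    Laplacian of [f] is at least [2 k - 2 c p > 0], which is impossible at a
    maximum. *)
Lemma hypersurface_onto P : [set: M] !=set0 ->
  edot (lsubmx P) (lsubmx P) = 2 * k%:R -> exists q, X q = P.
Proof.
move=> M0 Psph; set xP := lsubmx P in Psph *; pose yP := rsubmx P.
have kR : 1 <= k%:R :> R by rewrite ler1n.
(* Any positive [c] with [c * p < k] would do. *)
pose c : R := p.+1%:R^-1.
have c0 : 0 < c by rewrite invr_gt0.
have cp : c * p%:R < 1 by rewrite mulrC ltr_pdivrMr// mul1r ltr_nat.
pose f : 'rV[R]_(k.+1 + p) -> R := cyl_quad (-1) (- c) (2 *: xP) ((2 * c) *: yP).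
have [||q _ qmax] := @proper_max _ _ _ _ _ X_proper setT (f \o X)
    (2 * k%:R + 2 * c * edot yP yP + c * k%:R) (c / 2) closedT M0 _ (divr_gt0 c0 (ltr0n _ 2)).
- move=> q; apply: continuous_comp; first exact: continuous_immersion.
  exact: continuous_cyl_quad.
- move=> q _; rewrite /= /f cyl_quadE edot_split hypersurface_sphere !edotZl.
  have := edot_ge0 (xP - lsubmx (X q)).
  have := edot_ge0 (2 *: yP - rsubmx (X q)).
  rewrite !edotBB !(edotZl, edotZr) hypersurface_sphere Psph => h1 h2.
  have : 0 <= c * (2 * (2 * edot yP yP) - 2 * (2 * edot yP (rsubmx (X q))) +
    edot (rsubmx (X q)) (rsubmx (X q))) by rewrite mulr_ge0// ltW.
  by move: h2; move: (edot xP _) (edot yP _) (edot (rsubmx _) _) (edot yP _) => *; nra.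
exists q; set x := lsubmx (X q); set y := rsubmx (X q).
have xx : edot x x = 2 * k%:R by exact: hypersurface_sphere.
have [E [onE H]] := ex_tangent_frame X_proper X_shrinker q.
pose g : 'rV[R]_(k.+1 + p) := row_mx ((2 * -1) *: x + 2 *: xP) ((2 * - c) *: y + (2 * c) *: yP).
pose b : 'rV[R]_(k.+1 + p) := row_mx ((2 * 1) *: x + 0) ((2 * 0) *: y + 0).
have [|gE QE] : (forall i, edot g (E i) = 0) /\ _ :=
  H _ _ _ (@jet2_at_cyl_quad _ _ _ (-1) (- c) (2 *: xP) ((2 * c) *: yP) (X q)) _.
  by near=> q'; exact: qmax.
have [|bE QbE] : (forall i, edot b (E i) = 0) /\ _ :=
  H _ _ _ (@jet2_at_cyl_quad _ _ _ 1 0 0 0 (X q)) _.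
  by near=> q'; rewrite !cyl_quadE !hypersurface_sphere !mul0r !edot0l.
have b0 : b != 0.
  rewrite -edot_eq0 edot_split /b row_mxKl row_mxKr mulr0 scale0r !addr0 edot0l addr0.
  rewrite edotZl edotZr xx; apply: lt0r_neq0; lra.
have [l gl] : exists l, g = l *: b := normal_line onE bE gE b0.
have /= gx : (2 * -1) *: x + 2 *: xP = l *: ((2 * 1) *: x + 0).
  by have := congr1 lsubmx gl; rewrite linearZ/= !row_mxKl.
have /= gy : (2 * - c) *: y + (2 * c) *: yP = l *: ((2 * 0) *: y + 0).
  by have := congr1 rsubmx gl; rewrite linearZ/= !row_mxKr.
have yE : yP = y.
  apply/rowP => j; have := congr1 (fun v : 'rV_p => v 0 j) gy; rewrite !mxE.
  rewrite !mulr0 !mul0r addr0 mulr0 mulrN mulNr addrC => /eqP; rewrite subr_eq0 => /eqP.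
  by apply: mulfI; rewrite mulf_neq0// gt_eqF.
have xE : xP = (1 + l) *: x.
  apply/rowP => j; have := congr1 (fun v : 'rV_(k.+1) => v 0 j) gx; rewrite !mxE; lra.
have lE : (1 + l) ^+ 2 = 1.
  have : (1 + l) ^+ 2 * (2 * k%:R) = 1 * (2 * k%:R).
    by rewrite mul1r -[in RHS]Psph xE edotZl edotZr xx; ring.
  have k2 : 2 * k%:R != 0 :> R by apply: lt0r_neq0; lra.
  exact: (mulIf k2).
move: QE QbE; rewrite !edot_split !row_mxKl !row_mxKr !big_split/= -!mulr_sumr.
rewrite -/(lgrad E) -/(rgrad E) -/x -/y => QE QbE.
move: lE => /eqP; rewrite sqrf_eq1 => /orP[|] /eqP lE.
  by rewrite -(hsubmxK (X q)) -(hsubmxK P) -/x -/xP -/y -/yP yE xE lE scale1r.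
exfalso; move: QE QbE; rewrite xE lE yE !(edotDl, edotZl, edot0l) xx.
have := rgrad_le onE; have := lgradDrgrad onE; move: (lgrad E) (rgrad E) (edot y y) => u v w.
move=> _ vp QE QbE.
have : c * v < 1 by apply: le_lt_trans cp; rewrite ler_wpM2l// ltW.
lra.
Unshelve. all: by end_near. Qed.

End Hypersurface.

Lemma cylinder_erefl (R : realType) d p (A : set 'rV[R]_d) :
  cylinder (erefl (d + p)%N) A = [set x | A (lsubmx x)].
Proof. by apply/seteqP; split=> x; rewrite /cylinder/= castmx_id. Qed.

Theorem theorem17 (R : realType) (n m : nat) (M : smooth_manifold R n)
    (X : M -> 'rV[R]_m)
    (ltnm : (n < m)%N)
    (M_nonempty : [set: M] !=set0)
    (X_proper : properly_immersed X)
    (X_complete : complete_immersed X)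
    (X_shrinker : self_shrinker X) :
  (forall (k p : nat) (kpm : (k.+1 + p)%N = m) (a : 'rV[R]_k.+1),
     (m - n <= k <= m - 2)%N ->
     let r := Num.sqrt (2 * (n%:R - p%:R) + enorm a ^+ 2) in
     range X `<=` cylinder kpm (closure (eball a r)) ->
     range X `<=` cylinder kpm (esphere a r) /\
     (n = (m - 1)%N ->
      range X = cylinder kpm (esphere 0 (Num.sqrt (2 * k%:R))))) /\
  (forall (k p : nat) (kpm : (k.+1 + p)%N = m) (a : 'rV[R]_k.+1),
     (1 <= k <= n)%N ->
     let r := Num.sqrt (2 * k.+1%:R + enorm a ^+ 2) in
     ~ (range X `<=` ~` cylinder kpm (closure (eball a r)))).
Proof.
split=> k p kpm a kmn r; subst m; rewrite !cylinder_erefl; last first.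
  move=> out; apply: (not_outside X_proper X_shrinker (a := a) M_nonempty) => q.
  rewrite ltNge; apply/negP => le_q; have := out (X q) (imageT X q); apply=> /=.
  rewrite /r enorm_sqr; apply: closure_eball_ge => //.
  by rewrite ltr_wpDr ?edot_ge0// mulr_gt0// ltr0n.
rewrite {}/r enorm_sqr => sub.
have inside q : edot (lsubmx (X q) - a) (lsubmx (X q) - a) <=
    2 * (n%:R - p%:R) + edot a a.
  by apply: closure_eball_le; exact: sub (X q) (imageT X q).
split=> [_ [q _ <-] /=|nE].
  by rewrite /esphere/= /enorm (inside_sphere X_proper X_shrinker inside).
have {}nE : n = (k + p)%N by rewrite nE; lia.
have k0 : (0 < k)%N by move: kmn; rewrite nE; lia.
subst n; apply/seteqP; split=> [_ [q _ <-] /=|P /=]; rewrite /esphere/= subr0 /enorm.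
  by rewrite (hypersurface_sphere X_proper X_shrinker inside).
move=> /(congr1 (fun s => s ^+ 2)); rewrite !sqr_sqrtr ?edot_ge0 ?mulr_ge0//.
move=> /(hypersurface_onto X_proper X_shrinker k0 inside M_nonempty)[q <-].
exact: imageT.
Qed.
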